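(* Let $n$ be an even positive integer, $\bar n=n/2$, $\sigma>0$, and let $\mathcal{C}_{\bar n}$ be a finite collection of closed sub-intervals of $[0,1]$ with endpoints on the grid $\{i/\bar n: i=0,\dots,\bar n\}$. Let $\mathcal{D}$ be the set of all non-increasing functions from $[0,1]$ to $\mathbb{R}$. For every $\alpha\in(0,1)$, $$\sup_{f\in\mathcal{D}}\mathbb{P}_f\Bigl[\max_{I\in\mathcal{C}_{\bar n}}\hat S_{\bar n}^{\mathrm{reg},I}>r_{\alpha,n}\Bigr]=\alpha .$$ Moreover, the supremum over $f\in\mathcal{D}$ of $\mathbb{P}_f\bigl[\max_{I\in\mathcal{C}_{\bar n}}\hat S_{\bar n}^{\mathrm{reg},I}>r_{\alpha,n}\bigr]$ is achieved at $f\equiv c$, for any fixed $c\in\mathbb{R}$.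
   Context: Regression model: one observes $Y_i=f(i/n)+\sigma\epsilon_i$, $i=1,\dots,n$, where $f:[0,1]\to\mathbb{R}$ and $\sigma>0$ are unknown and $\epsilon_1,\dots,\epsilon_n$ are independent standard Gaussian variables; $n$ is even and $\bar n=n/2$. $\mathbb{P}_f$ denotes probability when the regression function is $f$. Define, for $i=1,\dots,\bar n$, $\bar Y_i=(Y_{2i-1}+Y_{2i})/2$ and $\bar\epsilon_i=(\epsilon_{2i-1}+\epsilon_{2i})/\sqrt2$, and $$\hat\sigma^2=\frac1n\sum_{i=1}^{n/2}(Y_{2i}-Y_{2i-1})^2,\qquad \hat\sigma_0^2=\hat\sigma^2/2 .$$ The cumulative sum diagram (with equal weights $1/\bar n$) of points $z_1,\dots,z_{\bar n}$ is the continuous piecewise linear function on $[0,1]$ interpolating the points $\bigl(j/\bar n,\frac1{\bar n}\sum_{i=1}^j z_i\bigr)$, $j=0,\dots,\bar n$. Let $F^{\mathrm{reg}}_{\bar n}$ be the cumulative sum diagram of $\bar Y_1,\dots,\bar Y_{\bar n}$ and $G_{\bar n}$ that of $\bar\epsilon_1,\dots,\bar\epsilon_{\bar n}$. For a continuous function $G:[0,1]\to\mathbb{R}$ and a closed sub-interval $I$, $\hat G^I$ denotes the least concave majorant of the restriction of $G$ to $I$; $|I|$ is the length of $I$. Set $$\hat S^{\mathrm{reg},I}_{\bar n}=\sqrt{\frac{\bar n}{\hat\sigma_0^2|I|}}\,\sup_{t\in I}\Bigl(\widehat{F^{\mathrm{reg}}_{\bar n}}^{I}(t)-F^{\mathrm{reg}}_{\bar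 n}(t)\Bigr),\qquad Z_n^{\mathrm{reg}}=\max_{I\in\mathcal{C}_{\bar n}}\sqrt{\frac{\bar n}{|I|}}\,\sup_{t\in I}\bigl(\hat G_{\bar n}^I(t)-G_{\bar n}(t)\bigr).$$ The threshold $r_{\alpha,n}$ is the $(1-\alpha)$-quantile of $Z_n^{\mathrm{reg}}/\sqrt{\chi^2(\bar n)/\bar n}$, where $\chi^2(\bar n)$ is a random variable independent of $Z_n^{\mathrm{reg}}$ having the chi-square distribution with $\bar n$ degrees of freedom.
   Formalization: Equality of the supremum with α is asserted only when α ≤ P[Z_n^reg > 0], since it fails otherwise (Z_n^reg has an atom at 0); for every α in (0,1) the supremum is shown to be at most α and attained at every constant. Intervals have positive length. *)

(* Defs.v *)
From HB Require Import structures.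
From mathcomp Require Import all_boot all_order all_algebra.
From mathcomp Require Import all_classical all_reals all_analysis.
From mathcomp Require Import lra.
Import Order.TTheory GRing.Theory Num.Theory.

Set Implicit Arguments.
Unset Strict Implicit.
Unset Printing Implicit Defensive.

Local Open Scope classical_set_scope.
Local Open Scope ring_scope.

Section cumulative_sums_and_majorants.
Context {R : realType}.
Implicit Types (A : set R) (G h : R -> R).

(* [convex_function] of the library does not bundle convexity of its domain;
   here the domain is always an interval. *)
Definition concave_on A h := @convex_function R R^o A (fun x => - h x).

Definition concave_majorants A G : set (R -> R) :=
  [set h | concave_on A h /\ {in A, forall t, G t <= h t}].

(* Pointwise infimum of all concave majorants; see [lcmaj_least]. *)
Definition lcmaj A G (t : R) : R := inf [set h t | h in concave_majorants A G].

Definition psum k (z : 'I_k -> R) (j : nat) : R :=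
  k%:R^-1 * \sum_(i < k | (i < j)%N) z i.

(* Linear interpolation of the points (j / k, psum z j), j = 0, ..., k:
   if j <= k * t < j + 1 then t is at fraction k * t - j of the way from
   j / k to (j + 1) / k. *)
Definition csd k (z : 'I_k -> R) (t : R) : R :=
  let j := Num.truncn (k%:R * t) in
  psum z j + (k%:R * t - j%:R) * (psum z j.+1 - psum z j).

Lemma csd_grid k (z : 'I_k -> R) (j : nat) : (0 < k)%N ->
  csd z (j%:R / k%:R) = psum z j.
Proof.
move=> k0; have kn0 : k%:R != 0 :> R by rewrite pnatr_eq0 -lt0n.
by rewrite /csd mulrCA divff// mulr1 natrK subrr mul0r addr0.
Qed.

Lemma concave_onP A h : concave_on A h <->
  forall x y t, A x -> A y -> 0 <= t <= 1 ->
    t * h x + (1 - t) * h y <= h (t * x + (1 - t) * y).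
Proof.
split=> [ch x y t Ax Ay /andP[t0 t1]|ch t x y /set_mem Ax /set_mem Ay].
  have t01 : Itv.spec (@Itv.num_sem R) (Itv.Real `[0%Z, 1%Z]%O) t.
    by rewrite /Itv.spec/= /Itv.num_sem/= in_itv/= t0 t1 ger0_real.
  have := ch (Itv.mk t01) x y (mem_set Ax) (mem_set Ay).
  by rewrite !convRE/= !mulrN -opprD lerN2.
rewrite !convRE !mulrN -opprD lerN2; apply: ch => //.
by rewrite ge0 le1.
Qed.

Lemma lcmaj_least A G (B : R) : is_interval A -> {in A, forall t, G t <= B} ->
  concave_majorants A G (lcmaj A G) /\
  forall h, concave_majorants A G h -> {in A, forall t, lcmaj A G t <= h t}.
Proof.
move=> iA GB.
have lbG t : A t -> lbound [set h t | h in concave_majorants A G] (G t).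
  by move=> At _ [h [_ Gh] <-]; apply: Gh; rewrite inE.
have has_infA t : A t -> has_inf [set h t | h in concave_majorants A G].
  move=> At; split; last by exists (G t); exact: lbG.
  exists B, (fun=> B) => //; split => //; apply/concave_onP => x y s _ _ _.
  by rewrite -mulrDl addrC subrK mul1r.
have lcmaj_le h t : concave_majorants A G h -> A t -> lcmaj A G t <= h t.
  by move=> hG At; apply: ge_inf; [exists (G t); exact: lbG|exists h].
split; last by move=> h hG t /set_mem; exact: lcmaj_le.
split; last first.
  by move=> t /set_mem At; apply: lb_le_inf; [case: (has_infA _ At)|exact: lbG].
apply/concave_onP => x y t Ax Ay /andP[t0 t1].
have Axy : A (t * x + (1 - t) * y).
  have [xy|/ltW yx] := leP x y.
    apply: (iA x y) => //; apply/andP; split; nra.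
  by apply: (iA y x) => //; apply/andP; split; nra.
apply: lb_le_inf; first by case: (has_infA _ Axy).
move=> _ [h hG <-]; apply: le_trans (_ : t * h x + (1 - t) * h y <= _).
  by rewrite lerD// ler_wpM2l ?subr_ge0// lcmaj_le.
by have [/concave_onP ch _] := hG; apply: ch; rewrite // t0 t1.
Qed.

End cumulative_sums_and_majorants.

Section intervals_on_the_grid.
Context {R : realType} (k : nat).

(* The pair (a, b) encodes the interval [a / k, b / k]. *)
Definition gitv : Type := ('I_k.+1 * 'I_k.+1)%type.

Implicit Type I : gitv.

Definition gset I : set R := `[I.1%:R / k%:R, I.2%:R / k%:R].

Definition glen I : R := I.2%:R / k%:R - I.1%:R / k%:R.

Definition lcm_gap I (G : R -> R) : R :=
  sup [set lcmaj (gset I) G t - G t | t in gset I].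

End intervals_on_the_grid.

Section statistics.
Context {R : realType} {n : nat}.
Implicit Types (x y e : 'I_n -> R) (C : {set gitv n./2}).

Lemma pair_snd_subproof (i : 'I_n./2) : (i.*2.+1 < n)%N.
Proof. by rewrite -gtn_half_double ltn_ord. Qed.

Lemma pair_fst_subproof (i : 'I_n./2) : (i.*2 < n)%N.
Proof. exact: ltnW (pair_snd_subproof i). Qed.

(* Indices start at 0, so that the i-th pair (Y_(2i-1), Y_(2i)) of the
   mathematical text is the pair of positions 2i and 2i + 1. *)
Definition pair_fst (i : 'I_n./2) : 'I_n := Ordinal (pair_fst_subproof i).
Definition pair_snd (i : 'I_n./2) : 'I_n := Ordinal (pair_snd_subproof i).

Definition Ybar y (i : 'I_n./2) : R := (y (pair_fst i) + y (pair_snd i)) / 2.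

Definition epsbar e (i : 'I_n./2) : R :=
  (e (pair_fst i) + e (pair_snd i)) / Num.sqrt 2.

Definition sigma2_hat y : R :=
  n%:R^-1 * \sum_(i < n./2) (y (pair_snd i) - y (pair_fst i)) ^+ 2.

Definition sigma2_hat0 y : R := sigma2_hat y / 2.

Definition Sreg y (I : gitv n./2) : R :=
  Num.sqrt (n./2%:R / (sigma2_hat0 y * glen I)) * lcm_gap I (csd (Ybar y)).

(* The values maximized here and in [Zreg] are nonnegative, so that 0 is a
   neutral default. *)
Definition max_Sreg C y : R := \big[Num.max/0]_(I in C) Sreg y I.

Definition Zreg C e : R :=
  \big[Num.max/0]_(I in C)
    (Num.sqrt (n./2%:R / glen I) * lcm_gap I (csd (epsbar e))).

Definition regression (f : R -> R) (sigma : R) e (i : 'I_n) : R :=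
  f (i.+1%:R / n%:R) + sigma * e i.

End statistics.

Section probability.
Context {R : realType}.

Local Notation mR := (measurableTypeR R).

Definition add_sqr (x : mR * mR) : mR := x.1 + x.2 ^+ 2.

Lemma measurable_add_sqr : measurable_fun [set: mR * mR] add_sqr.
Proof.
apply: measurable_realfun.measurable_funD => //.
exact: measurable_realfun.measurable_funX.
Qed.

HB.instance Definition _ :=
  isMeasurableFun.Build _ _ (mR * mR)%type mR add_sqr measurable_add_sqr.

(* Law of the sum of the squares of k independent standard normal variables. *)
Fixpoint chi2 (k : nat) : probability mR R :=
  if k is k'.+1 then
    distribution (chi2 k' \x (normal_prob 0 1 : probability mR R))%E add_sqr
  else dirac (0 : mR).

Definition quantile d (T : measurableType d) (P : probability T R)
    (X : T -> R) (p : R) : R :=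
  inf [set x | (p%:E <= P [set w | (X w <= x)%R])%E].

Section sample.
Context d {T : measurableType d} (P : probability T R).

Definition independent_RVs n (X : 'I_n -> {RV P >-> R}) :=
  forall (J : {set 'I_n}) (A : 'I_n -> set R),
    (forall i, measurable (A i)) ->
    P (\bigcap_(i in [set` J]) (X i @^-1` A i)) =
    (\prod_(i in J) P (X i @^-1` A i))%E.

Definition standard_normal (X : {RV P >-> R}) :=
  forall A : set R, measurable A -> distribution P X A = normal_prob 0 1 A.

(* The variable independent of [Zreg] with law [chi2 n./2] is the second
   coordinate of the product space of P and [chi2 n./2]. Since [Zreg] has an
   atom at 0 (it vanishes when the [epsbar] are nonincreasing), the threshold
   is 0 as soon as alpha is at least the probability of [0 < Zreg]; above
   that probability alpha is not a value of the tail function. *)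
Definition threshold n (C : {set gitv n./2}) (eps : 'I_n -> {RV P >-> R})
    (alpha : R) : R :=
  quantile (P \x chi2 n./2)%E
    (fun w => Zreg C (eps ^~ w.1) / Num.sqrt (w.2 / n./2%:R)) (1 - alpha).

(* Probability, when the regression function is f, that the largest statistic
   exceeds r. *)
Definition rejection_prob n (C : {set gitv n./2}) (eps : 'I_n -> {RV P >-> R})
    (sigma r : R) (f : R -> R) : \bar R :=
  P [set w | r < max_Sreg C (regression f sigma (eps ^~ w))].

End sample.
End probability.

(* Only the values on [0, 1] matter, here and in [regression]. *)
Definition nonincreasing01 {R : realType} : set (R -> R) :=
  [set f | {in `[0, 1] &, forall x y : R, x <= y -> f y <= f x}].

(* Main.v *)
Require Import Defs.
From HB Require Import structures.
From mathcomp Require Import all_boot all_order all_algebra.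
From mathcomp Require Import all_classical all_reals all_analysis.
From mathcomp Require Import measurable_realfun.
From mathcomp Require Import zify ring lra.
Import Order.TTheory GRing.Theory Num.Theory.

(** The gap between a function and its least concave majorant on an interval is
    a sublinear functional of the function ([lcm_gapD], [lcm_gapZ_le]) that
    vanishes on concave functions ([lcm_gap_concave]).

    Write k = n / 2 and rotate each pair of noise variables by an eighth of a
    turn, into a normalized sum U_i = [epsbar] and a normalized difference
    W_i = [epsdiff].  The numerators of the statistics depend on the noise only
    through the U_i, the variance estimator only through the W_i.
    - If f is constant, the cumulative diagram of the pair means is that of the
      U_i, rescaled, plus a linear function, so that the largest statistic is
      exactly [Zreg] / sqrt (V / k), where V is the sum of the W_i ^ 2
      ([max_Sreg_cst]).
    - If f is nonincreasing, the diagram of its pair means is concave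
      ([csd_concave]) and can only lower the numerators, while V becomes the
      sum of the (W_i + b_i) ^ 2 for some constants b_i ([max_Sreg_le]).

    The law of a pair of independent standard normal variables is invariant
    under rotation ([normal_prob_rotation]); hence the U_i and W_i are again
    independent and standard normal ([rotated_noise_joint]), and [Zreg] is
    independent of V ([Zreg_sumsq_law]).  In the constant case the largest
    statistic therefore has exactly the law whose quantile is the threshold.
    In general, Anderson's inequality in dimension one, applied to one
    square after the other, says that the shifts b_i make V stochastically
    larger ([normal_prob_ball_shift], [noncentral_chi2_lt]); conditionally on
    [Zreg], exceeding a nonnegative level means that V is small, so that
    rejection is most likely when f is constant ([studentize_tail_le]).

    It remains to evaluate the tail of [Zreg] / sqrt (V / k) at its quantile.
    It is at most alpha because distribution functions are right continuous
    ([prob_gt_quantile]), and equal to alpha unless there is an atom at the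
    quantile ([prob_gt_quantile_eq]).  As chi-square laws have no atoms
    ([chi2_set1]), the only possible atom is at 0, with the mass of the event
    that [Zreg] vanishes; it does no harm as long as alpha is at most the
    probability that [Zreg] is positive. *)

Set Implicit Arguments.
Unset Strict Implicit.
Unset Printing Implicit Defensive.

Local Open Scope classical_set_scope.
Local Open Scope ring_scope.

(** * Cumulative sum diagrams *)

Section cumulative_sum_diagram.
Context {R : realType}.

Definition ramp (x : R) : R := Num.min 1 (Num.max 0 x).

Lemma ramp_ge0 x : 0 <= ramp x.
Proof. by rewrite /ramp le_min ler01 le_max lexx. Qed.

Lemma ramp_le1 x : ramp x <= 1.
Proof. by rewrite /ramp ge_min lexx. Qed.

Lemma ramp0 x : x <= 0 -> ramp x = 0.
Proof. by move=> x0; rewrite /ramp max_l// min_r// ler01. Qed.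

Lemma ramp1 x : 1 <= x -> ramp x = 1.
Proof.
move=> x1; rewrite /ramp min_l// le_max; apply/orP; right; exact: x1.
Qed.

Lemma ramp_id x : 0 <= x <= 1 -> ramp x = x.
Proof. by move=> /andP[x0 x1]; rewrite /ramp max_r// min_r. Qed.

(** Each increment [z i] enters the diagram through a fixed ramp on the i-th
    cell; this makes bounds and slopes of the diagram readable term by term. *)
Lemma csdE k (z : 'I_k -> R) (t : R) : 0 <= t ->
  csd z t = k%:R^-1 * \sum_(i < k) z i * ramp (k%:R * t - i%:R).
Proof.
move=> t0; rewrite /csd; set j := Num.truncn _.
have kt0 : 0 <= k%:R * t by rewrite mulr_ge0.
have /andP[jl jr] : j%:R <= k%:R * t < j.+1%:R by exact: truncn_itv.
have psumE m : psum z m = k%:R^-1 * \sum_(i < k) z i * (i < m)%N%:R.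
  rewrite /psum big_mkcond/=; congr (_ * _); apply: eq_bigr => i _.
  by case: ifP; rewrite ?mulr1 ?mulr0.
rewrite !psumE -mulrBr mulrCA -mulrDr; congr (_ * _).
rewrite -sumrB mulr_sumr -big_split/=; apply: eq_bigr => i _.
rewrite -mulrBr mulrCA -mulrDr; congr (_ * _).
rewrite -natr1 in jr.
case: (ltngtP i j) => ij.
- rewrite ltnS (ltnW ij) subrr mulr0 addr0 ramp1//.
  move: ij; rewrite -(ler_nat R) -natr1; lra.
- rewrite ltnS leqNgt ij subrr mulr0 addr0 ramp0//.
  move: ij; rewrite -(ler_nat R) -natr1; lra.
- rewrite ij ltnSn subr0 mulr1 add0r ramp_id//.
  by apply/andP; split; lra.
Qed.

Lemma sum_ramp (m : nat) (x : R) : 0 <= x <= m%:R ->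
  \sum_(i < m) ramp (x - i%:R) = x.
Proof.
elim: m x => [|m IH] x /andP[x0 xm].
  by rewrite big_ord0; lra.
rewrite big_ord_recr/=; have [xlem|mlex] := leP x m%:R.
  by rewrite IH ?x0// ramp0 ?addr0//; lra.
rewrite -natr1 in xm.
rewrite ramp_id; last by apply/andP; split; lra.
rewrite -{1}(IH m%:R) ?ler0n ?lexx// in mlex *.
rewrite (eq_bigr (fun i : 'I_m => ramp (m%:R - i%:R))) => [|i _].
  by rewrite IH ?ler0n ?lexx//; lra.
have := ltn_ord i; rewrite -(ler_nat R) -natr1 => im.
by rewrite !ramp1//; move: mlex; rewrite IH ?ler0n ?lexx//; lra.
Qed.

Lemma csdD k (z z' : 'I_k -> R) t :
  csd (fun i => z i + z' i) t = csd z t + csd z' t.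
Proof.
have psumD m : psum (fun i => z i + z' i) m = psum z m + psum z' m.
  by rewrite /psum big_split/= mulrDr.
by rewrite /csd !psumD; ring.
Qed.

Lemma csdZ k (z : 'I_k -> R) c t : csd (fun i => c * z i) t = c * csd z t.
Proof.
have psumZ m : psum (fun i => c * z i) m = c * psum z m.
  by rewrite /psum -mulr_sumr mulrCA.
by rewrite /csd !psumZ; ring.
Qed.

Lemma csd_bound k (z : 'I_k -> R) t : 0 <= t ->
  `|csd z t| <= \sum_(i < k) `|z i|.
Proof.
move=> t0; rewrite csdE// normrM ger0_norm ?invr_ge0//.
case: k z => [|k] z; first by rewrite !big_ord0 normr0 mulr0.
apply: (@le_trans _ _ (1 * \sum_(i < k.+1) `|z i|)); last by rewrite mul1r.
apply: ler_pM; rewrite ?invr_ge0//.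
  by rewrite invf_le1// ler1n.
apply: le_trans (ler_norm_sum _ _ _) _; apply: ler_sum => i _.
rewrite normrM ler_piMr// ger0_norm ?ramp_ge0//; exact: ramp_le1.
Qed.

(** The slope [z j] on the cell that contains [x] is a supergradient at [x]:
    the cells to the right of it have smaller slopes, those to the left have
    larger ones. *)
Lemma csd_concave k (z : 'I_k -> R) (A : set R) :
  (forall i j : 'I_k, (i <= j)%N -> z j <= z i) ->
  A `<=` `[0, 1] -> concave_on A (csd z).
Proof.
move=> zd A01; case: k z zd => [|k] z zd.
  apply/concave_onP => x y t Ax Ay /andP[t0 t1].
  by rewrite /csd /psum invr0 !mul0r subrr mulr0 !addr0 !mulr0.
suff super x : 0 <= x <= 1 -> exists s, forall y, 0 <= y <= 1 ->
    csd z y <= csd z x + s * (y - x).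
  apply/concave_onP => x y t /A01 + /A01 + /andP[t0 t1].
  rewrite /= !in_itv/= => /andP[x0 x1] /andP[y0 y1].
  have [|s hs] := super (t * x + (1 - t) * y).
    by apply/andP; split; nra.
  have hx : csd z x <= _ := hs x (introT andP (conj x0 x1)).
  have hy : csd z y <= _ := hs y (introT andP (conj y0 y1)).
  set c := csd z (_ + _) in hx hy *.
  have h1t : 0 <= 1 - t by lra.
  have := lerD (ler_wpM2l t0 hx) (ler_wpM2l h1t hy).
  by move/le_trans; apply; rewrite le_eqVlt; apply/orP; left; apply/eqP; ring.
move=> /andP[x0 x1].
(* The cell of [x]; the right endpoint [x = 1] is put in the last cell. *)
have [j [jl jr]] : exists j : 'I_k.+1,
    (forall i : 'I_k.+1, (i < j)%N -> ramp (k.+1%:R * x - i%:R) = 1) /\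
    (forall i : 'I_k.+1, (j < i)%N -> ramp (k.+1%:R * x - i%:R) = 0).
  have kx0 : 0 <= k.+1%:R * x by rewrite mulr_ge0.
  have kxk : k.+1%:R * x <= k.+1%:R by rewrite ler_piMr.
  have /andP[] := truncn_itv kx0; move: (Num.truncn _) => m ml mr.
  have mk : (minn m k < k.+1)%N by rewrite ltnS geq_minr.
  exists (Ordinal mk); split=> i /=.
    rewrite leq_min => /andP[im _]; apply: ramp1.
    by move: im; rewrite -(ler_nat R) -natr1; lra.
  move=> mi; apply: ramp0.
  have : (m < i)%N by case: i mi => i /=; lia.
  by rewrite -(ler_nat R); lra.
exists (z j) => y /andP[y0 y1].
have kn0 : k.+1%:R != 0 :> R by rewrite pnatr_eq0.
have itv (u : R) : 0 <= u <= 1 -> 0 <= k.+1%:R * u <= k.+1%:R.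
  by move=> /andP[u0 u1]; rewrite mulr_ge0//= ler_piMr.
have -> : y - x = k.+1%:R^-1 *
    \sum_(i < k.+1) (ramp (k.+1%:R * y - i%:R) - ramp (k.+1%:R * x - i%:R)).
  rewrite sumrB sum_ramp ?itv ?y0// sum_ramp ?itv ?x0//.
  by rewrite -mulrBr mulKf.
rewrite !csdE// mulrCA -mulrDr ler_pM2l ?invr_gt0 ?ltr0n// mulr_sumr.
rewrite -big_split/=; apply: ler_sum => i _.
have [ij|ji|ij] := ltngtP i j.
- have := zd i j (ltnW ij); rewrite jl//; have := ramp_le1 (k.+1%:R * y - i%:R).
  by nra.
- have := zd j i (ltnW ji); rewrite jr//; have := ramp_ge0 (k.+1%:R * y - i%:R).
  by nra.
- rewrite (ord_inj ij); lra.
Qed.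

End cumulative_sum_diagram.

(** * The gap to the least concave majorant *)

Section least_concave_majorant_gap.
Context {R : realType} (k : nat).
Implicit Types (I : gitv k) (G H : R -> R).

Lemma gset01 I : (gset I : set R) `<=` `[0, 1].
Proof.
case: k I => [|k'] I t; rewrite /gset /= !in_itv/= => /andP[lt tr].
  by move: lt tr; rewrite invr0 !mulr0 => -> /le_trans ->.
rewrite (le_trans _ lt) ?divr_ge0//= (le_trans tr)//.
by rewrite ler_pdivrMr ?ltr0n// mul1r ler_nat -ltnS.
Qed.

Lemma gset_interval I : is_interval (gset I : set R).
Proof. exact: interval_is_interval. Qed.

Lemma gset_fst I : (I.1 < I.2)%N -> gset I (I.1%:R / k%:R : R).
Proof.
move=> I12; rewrite /gset/= in_itv/= lexx/= ler_wpM2r ?invr_ge0//.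
by rewrite ler_nat ltnW.
Qed.

Lemma concave_on_cst (A : set R) (c : R) : concave_on A (fun=> c).
Proof.
by apply/concave_onP => x y t _ _ _; rewrite -mulrDl addrC subrK mul1r.
Qed.

Lemma concave_onD (A : set R) G H :
  concave_on A G -> concave_on A H -> concave_on A (fun t => G t + H t).
Proof.
move=> /concave_onP cG /concave_onP cH; apply/concave_onP => x y t Ax Ay t01.
by have := lerD (cG _ _ _ Ax Ay t01) (cH _ _ _ Ax Ay t01); lra.
Qed.

Lemma concave_onZ (A : set R) (c : R) G : 0 <= c ->
  concave_on A G -> concave_on A (fun t => c * G t).
Proof.
move=> c0 /concave_onP cG; apply/concave_onP => x y t Ax Ay t01.
by have := ler_wpM2l c0 (cG _ _ _ Ax Ay t01); lra.
Qed.

Lemma lcmaj_le_majorant (A : set R) G h B t : is_interval A ->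
  (forall t, A t -> `|G t| <= B) -> concave_majorants A G h -> A t ->
  lcmaj A G t <= h t.
Proof.
move=> iA GB hG At.
have [|_ least] := @lcmaj_least R A G B iA.
  by move=> u /set_mem /GB; apply: le_trans; exact: ler_norm.
by apply: least; rewrite // inE.
Qed.

Lemma lcmaj_is_majorant (A : set R) G B : is_interval A ->
  (forall t, A t -> `|G t| <= B) -> concave_majorants A G (lcmaj A G).
Proof.
move=> iA GB; have [|//] := @lcmaj_least R A G B iA.
by move=> u /set_mem /GB; apply: le_trans; exact: ler_norm.
Qed.

Section one_interval.
Variables (I : gitv k) (I12 : (I.1 < I.2)%N).

Local Notation A := (gset I : set R).

Lemma lcm_gap_le G (M : R) :
  (forall t, A t -> lcmaj A G t - G t <= M) -> lcm_gap I G <= M.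
Proof.
move=> GM; apply: ge_sup.
  by exists (lcmaj A G (I.1%:R / k%:R) - G (I.1%:R / k%:R)), (I.1%:R / k%:R);
    first exact: gset_fst.
by move=> _ [t At <-]; exact: GM.
Qed.

Lemma le_lcm_gap G B t : (forall t, A t -> `|G t| <= B) -> A t ->
  lcmaj A G t - G t <= lcm_gap I G.
Proof.
move=> GB At; apply: ub_le_sup; last by exists t.
exists (B + B) => _ [u Au <-]; apply: lerD.
  apply: (lcmaj_le_majorant (h := fun=> B) (@gset_interval I) GB) => //.
  split; first exact: concave_on_cst.
  by move=> v /set_mem /GB; apply: le_trans; exact: ler_norm.
by rewrite (le_trans _ (GB _ Au))// -normrN ler_norm.
Qed.

Lemma lcm_gap_ge0 G B : (forall t, A t -> `|G t| <= B) -> 0 <= lcm_gap I G.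
Proof.
move=> GB; have At := gset_fst I12.
apply: le_trans (le_lcm_gap GB At); rewrite subr_ge0.
by have [_] := lcmaj_is_majorant (@gset_interval I) GB; apply; rewrite inE.
Qed.

(** Concave majorants of [G] and of [H] add up to one of [G + H]. *)
Lemma lcm_gapD G H B B' : (forall t, A t -> `|G t| <= B) ->
    (forall t, A t -> `|H t| <= B') ->
  lcm_gap I (fun t => G t + H t) <= lcm_gap I G + lcm_gap I H.
Proof.
move=> GB HB; apply: lcm_gap_le => t At.
apply: le_trans (lerD (le_lcm_gap GB At) (le_lcm_gap HB At)).
suff : lcmaj A (fun t => G t + H t) t <= lcmaj A G t + lcmaj A H t by lra.
have GHB u : A u -> `|G u + H u| <= B + B'.
  by move=> Au; apply: le_trans (ler_normD _ _) _; rewrite lerD ?GB ?HB.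
apply: (lcmaj_le_majorant (h := fun t => lcmaj A G t + lcmaj A H t)
          (@gset_interval I) GHB) => //.
have [cG mG] := lcmaj_is_majorant (@gset_interval I) GB.
have [cH mH] := lcmaj_is_majorant (@gset_interval I) HB.
split; first exact: concave_onD.
by move=> u Au; rewrite lerD ?mG ?mH.
Qed.

Lemma lcm_gapZ_le G B (c : R) : 0 <= c -> (forall t, A t -> `|G t| <= B) ->
  lcm_gap I (fun t => c * G t) <= c * lcm_gap I G.
Proof.
move=> c0 GB; apply: lcm_gap_le => t At.
apply: le_trans (ler_wpM2l c0 (le_lcm_gap GB At)).
rewrite mulrBr lerB//.
have cGB u : A u -> `|c * G u| <= c * B.
  by move=> Au; rewrite normrM ger0_norm// ler_wpM2l ?GB.
apply: (lcmaj_le_majorant (h := fun t => c * lcmaj A G t)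
          (@gset_interval I) cGB) => //.
have [cG mG] := lcmaj_is_majorant (@gset_interval I) GB.
split; first exact: concave_onZ.
by move=> u Au; rewrite ler_wpM2l ?mG.
Qed.

(** A concave function is a concave majorant of itself. *)
Lemma lcm_gap_concave G B : (forall t, A t -> `|G t| <= B) ->
  concave_on A G -> lcm_gap I G <= 0.
Proof.
move=> GB cG; apply: lcm_gap_le => t At; rewrite subr_le0.
apply: (lcmaj_le_majorant (@gset_interval I) GB) => //.
by split => // u _; exact: lexx.
Qed.

Lemma lcm_gap_bound G B : (forall t, A t -> `|G t| <= B) ->
  lcm_gap I G <= B + B.
Proof.
move=> GB; apply: lcm_gap_le => t At; apply: lerD.
  apply: (lcmaj_le_majorant (h := fun=> B) (@gset_interval I) GB) => //.
  split; first exact: concave_on_cst.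
  by move=> v /set_mem /GB; apply: le_trans; exact: ler_norm.
by rewrite (le_trans _ (GB _ At))// -normrN ler_norm.
Qed.

End one_interval.

End least_concave_majorant_gap.

Section max_gap.
Context {R : realType} (k : nat) (C : {set gitv k}).
Hypothesis C12 : forall I : gitv k, I \in C -> (I.1 < I.2)%N.
Implicit Type z : 'I_k -> R.

Definition max_gap z : R :=
  \big[Num.max/0]_(I in C) (Num.sqrt (k%:R / glen I) * lcm_gap I (csd z)).

Let csd_bd (I : gitv k) z t : gset I t -> `|csd z t| <= \sum_(i < k) `|z i|.
Proof.
by move=> /gset01; rewrite /= in_itv/= => /andP[t0 _]; exact: csd_bound.
Qed.

Lemma max_gap_ge0 z : 0 <= max_gap z.
Proof. exact: bigmax_ge_id. Qed.

Lemma max_gap_le z (M : R) : 0 <= M ->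
  (forall I, I \in C -> Num.sqrt (k%:R / glen I) * lcm_gap I (csd z) <= M) ->
  max_gap z <= M.
Proof. by move=> M0 zM; apply: bigmax_le. Qed.

Lemma le_max_gap z (I : gitv k) : I \in C ->
  Num.sqrt (k%:R / glen I) * lcm_gap I (csd z) <= max_gap z.
Proof. 
by move=> IC; apply: (le_bigmax_cond _
  (fun I => Num.sqrt (k%:R / glen I) * lcm_gap I (csd z))).
Qed.

Lemma max_gapD z z' :
  max_gap (fun i => z i + z' i) <= max_gap z + max_gap z'.
Proof.
apply: max_gap_le => [|I IC]; first by rewrite addr_ge0 ?max_gap_ge0.
apply: le_trans (lerD (le_max_gap z IC) (le_max_gap z' IC)).
rewrite -mulrDr ler_wpM2l ?sqrtr_ge0//.
rewrite (_ : csd _ = fun t => csd z t + csd z' t); last first.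
  by apply/funext => t; rewrite csdD.
by apply: lcm_gapD (C12 IC) _ _ _ _ (@csd_bd I z) (@csd_bd I z').
Qed.

Lemma max_gapZ_le z c : 0 <= c -> max_gap (fun i => c * z i) <= c * max_gap z.
Proof.
move=> c0; apply: max_gap_le => [|I IC]; first by rewrite mulr_ge0 ?max_gap_ge0.
apply: le_trans (ler_wpM2l c0 (le_max_gap z IC)).
rewrite [leRHS]mulrCA ler_wpM2l ?sqrtr_ge0//.
rewrite (_ : csd _ = fun t => c * csd z t); last first.
  by apply/funext => t; rewrite csdZ.
by apply: lcm_gapZ_le (C12 IC) _ _ _ c0 (@csd_bd I z).
Qed.

Lemma max_gapZ z c : 0 < c -> max_gap (fun i => c * z i) = c * max_gap z.
Proof.
move=> c0; apply/eqP; rewrite eq_le max_gapZ_le ?(ltW c0)//=.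
rewrite -ler_pdivlMl//.
apply: le_trans (max_gapZ_le (fun i => c * z i) (ltW _));
  last by rewrite invr_gt0.
rewrite (_ : (fun i => _) = z)//; apply/funext => i.
by rewrite mulKf// gt_eqF.
Qed.

Lemma max_gap_nonincreasing z :
  (forall i j : 'I_k, (i <= j)%N -> z j <= z i) -> max_gap z = 0.
Proof.
move=> zd; apply/eqP; rewrite eq_le max_gap_ge0 andbT.
apply: max_gap_le => // I IC; rewrite mulr_ge0_le0 ?sqrtr_ge0//.
apply: lcm_gap_concave (C12 IC) _ _ (@csd_bd I z) _.
by apply: csd_concave => //; exact: gset01.
Qed.

(** The diagram of a constant sequence is linear; by subadditivity, adding it
    or subtracting it does not increase the gap. *)
Lemma max_gap_addl_cst z c : max_gap (fun i => c + z i) = max_gap z.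
Proof.
have le c' z' : max_gap (fun i => c' + z' i) <= max_gap z'.
  by apply: le_trans (max_gapD _ _) _; rewrite max_gap_nonincreasing ?add0r.
apply/eqP; rewrite eq_le le/=.
apply: le_trans (le (- c) (fun i => c + z i)).
rewrite (_ : (fun i => _) = z)//; apply/funext => i; exact: addKr.
Qed.

(** The gap is a supremum over a continuum of infima over all majorants; its
    measurability comes from this bound, which follows from subadditivity. *)
Lemma max_gap_lipschitz : exists L : R, 0 < L /\ forall z z',
  max_gap z <= max_gap z' + L * \sum_(i < k) `|z i - z' i|.
Proof.
pose S : R := \big[Num.max/0]_(I in C) Num.sqrt (k%:R / glen I).
have S0 : 0 <= S by exact: bigmax_ge_id.
exists (S * 2 + 1); split=> [|z z']; first by rewrite ltr_wpDl ?mulr_ge0.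
rewrite {1}(_ : z = (fun i => z' i + (z i - z' i))); last first.
  by apply/funext => i; rewrite addrC subrK.
apply: le_trans (max_gapD _ _) _; rewrite lerD2l.
set T := \sum_(i < k) _; have T0 : 0 <= T by exact: sumr_ge0.
apply: (@le_trans _ _ (S * (T + T))); last by lra.
apply: max_gap_le => [|I IC]; first by rewrite mulr_ge0 ?addr_ge0.
apply: ler_pM; rewrite ?sqrtr_ge0//.
- by apply: lcm_gap_ge0 (C12 IC) _ _ (@csd_bd I _).
- exact: (le_bigmax_cond _ (fun I => Num.sqrt (k%:R / glen I))).
- by apply: lcm_gap_bound (C12 IC) _ _ (@csd_bd I _).
Qed.

End max_gap.

(** * The statistics as functions of the rotated noise *)

Section statistics_in_noise.
Context {R : realType} {n : nat}.
Implicit Types (e : 'I_n -> R) (C : {set gitv n./2}).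

Definition epsdiff e (i : 'I_n./2) : R :=
  (e (pair_snd i) - e (pair_fst i)) / Num.sqrt 2.

Definition shifted_sumsq (b : nat -> R) e : R :=
  \sum_(i < n./2) (epsdiff e i + b i) ^+ 2.

(** The shift that [f] causes in the i-th normalized difference: the difference
    of the two observations of a pair is [sigma * sqrt 2] times
    [epsdiff + drift]. *)
Definition drift (f : R -> R) (sigma : R) (i : nat) : R :=
  (f (i.*2.+2%:R / n%:R) - f (i.*2.+1%:R / n%:R)) / (sigma * Num.sqrt 2).

Definition studentize (k : nat) (z v : R) : R := z / Num.sqrt (v / k%:R).

Lemma studentize_le k z z' v : z <= z' -> studentize k z v <= studentize k z' v.
Proof. by move=> zz'; rewrite ler_wpM2r// invr_ge0 sqrtr_ge0. Qed.

Lemma max_SregE C (y : 'I_n -> R) :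
  (forall I : gitv n./2, I \in C -> (I.1 < I.2)%N) ->
  max_Sreg C y = max_gap C (Ybar y) / Num.sqrt (sigma2_hat0 y).
Proof.
move=> C12; rewrite /max_Sreg /max_gap.
have s0 : 0 <= sigma2_hat0 y.
  by rewrite divr_ge0// mulr_ge0 ?invr_ge0// sumr_ge0// => i _; rewrite sqr_ge0.
rewrite (big_morph (fun x => x / Num.sqrt (sigma2_hat0 y))
  (id1 := 0) (op1 := Num.max)); last 2 first.
- by move=> x z; rewrite maxr_pMl// invr_ge0 sqrtr_ge0.
- by rewrite mul0r.
apply: eq_bigr => I IC; rewrite /Sreg invfM mulrCA sqrtrM ?invr_ge0//.
rewrite sqrtrV//; ring.
Qed.

Lemma regression_variance (f : R -> R) (sigma : R) e :
    (0 < n)%N -> ~~ odd n -> 0 < sigma ->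
  Num.sqrt (sigma2_hat0 (regression f sigma e)) =
  sigma / Num.sqrt 2 *
  Num.sqrt (shifted_sumsq (drift f sigma) e / n./2%:R).
Proof.
move=> n0 nodd s0.
have q0 : 0 < Num.sqrt 2 :> R by rewrite sqrtr_gt0.
have q2 : Num.sqrt 2 ^+ 2 = 2 :> R by rewrite sqr_sqrtr.
have nE : n%:R = 2 * n./2%:R :> R.
  by rewrite -natrM mul2n even_halfK.
have k0 : n./2%:R != 0 :> R by rewrite pnatr_eq0; lia.
have -> : sigma2_hat0 (regression f sigma e) =
    (sigma / Num.sqrt 2) ^+ 2 * (shifted_sumsq (drift f sigma) e / n./2%:R).
  rewrite /sigma2_hat0 /sigma2_hat /shifted_sumsq.
  rewrite (eq_bigr (fun i : 'I_n./2 => (2 * sigma ^+ 2) *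
      (epsdiff e i + drift f sigma i) ^+ 2)).
    rewrite -mulr_sumr nE expr_div_n q2; field; exact: k0.
  move=> i _; rewrite -[X in X * sigma ^+ 2]q2 -exprMn -exprMn; congr (_ ^+ 2).
  rewrite /regression /epsdiff /drift /=.
  by field; rewrite !gt_eqF.
rewrite sqrtrM ?sqr_ge0// sqrtr_sqr ger0_norm// divr_ge0// ltW//.
Qed.

Lemma regression_mean (f : R -> R) (sigma : R) e i :
  Ybar (regression f sigma e) i =
  Ybar (fun j => f (j.+1%:R / n%:R)) i + sigma / Num.sqrt 2 * epsbar e i.
Proof.
have q2 : Num.sqrt 2 ^+ 2 = 2 :> R by rewrite sqr_sqrtr.
by rewrite /Ybar /epsbar mulrACA -invfM -expr2 q2 /regression; field.
Qed.

Lemma max_Sreg_studentize C (f : R -> R) (sigma : R) e :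
    (0 < n)%N -> ~~ odd n -> 0 < sigma ->
    (forall I : gitv n./2, I \in C -> (I.1 < I.2)%N) ->
  max_Sreg C (regression f sigma e) =
  studentize n./2 (max_gap C (Ybar (regression f sigma e)) /
    (sigma / Num.sqrt 2)) (shifted_sumsq (drift f sigma) e).
Proof.
move=> n0 nodd s0 C12; rewrite max_SregE// regression_variance// /studentize.
by rewrite [in LHS]invfM mulrA.
Qed.

(** The diagram of the pair means of [f] is concave, so by subadditivity it
    does not increase the gap; the factor [sigma / sqrt 2] cancels between the
    numerator and the variance estimator. *)
Lemma max_Sreg_le C (f : R -> R) (sigma : R) e :
    (0 < n)%N -> ~~ odd n -> 0 < sigma ->
    (forall I : gitv n./2, I \in C -> (I.1 < I.2)%N) ->
    nonincreasing01 f ->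
  max_Sreg C (regression f sigma e) <=
  studentize n./2 (Zreg C e) (shifted_sumsq (drift f sigma) e).
Proof.
move=> n0 nodd s0 C12 fd.
have q0 : 0 < sigma / Num.sqrt 2 :> R by rewrite divr_gt0 ?sqrtr_gt0.
rewrite max_Sreg_studentize//; apply: studentize_le.
rewrite (_ : Zreg C e = max_gap C (epsbar e))//.
rewrite ler_pdivrMr// mulrC -max_gapZ//.
rewrite (_ : Ybar _ = fun i => Ybar (fun j : 'I_n => f (j.+1%:R / n%:R)) i +
    sigma / Num.sqrt 2 * epsbar e i); last first.
  by apply/funext => i; rewrite regression_mean.
apply: le_trans (max_gapD C12 _ _) _.
rewrite [X in X + _](max_gap_nonincreasing C12) ?add0r// => i j ij.
have fle (a b : nat) : (a <= b)%N -> (b < n)%N ->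
    f (b.+1%:R / n%:R) <= f (a.+1%:R / n%:R).
  move=> ab bn; have nn : 0 < n%:R :> R by rewrite ltr0n.
  have in01 (c : nat) : (c < n)%N -> (c.+1%:R / n%:R : R) \in `[0, 1].
    by move=> cn; rewrite in_itv/= divr_ge0//= ler_pdivrMr// mul1r ler_nat.
  apply: fd; rewrite ?in01//; first exact: leq_ltn_trans bn.
  by rewrite ler_wpM2r ?invr_ge0// ler_nat.
have j2 := pair_snd_subproof j.
rewrite /Ybar ler_wpM2r// lerD// fle//= ?ltnS ?leq_double//; exact: ltnW.
Qed.

Lemma max_Sreg_cst C (c sigma : R) e :
    (0 < n)%N -> ~~ odd n -> 0 < sigma ->
    (forall I : gitv n./2, I \in C -> (I.1 < I.2)%N) ->
  max_Sreg C (regression (fun=> c) sigma e) =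
  studentize n./2 (Zreg C e) (shifted_sumsq (fun=> 0) e).
Proof.
move=> n0 nodd s0 C12.
have q0 : 0 < sigma / Num.sqrt 2 :> R by rewrite divr_gt0 ?sqrtr_gt0.
rewrite max_Sreg_studentize//.
rewrite (_ : drift (fun=> c) sigma = (fun=> 0)); last first.
  by apply/funext => i; rewrite /drift subrr mul0r.
rewrite (_ : Ybar _ = fun i => c + sigma / Num.sqrt 2 * epsbar e i); last first.
  by apply/funext => i; rewrite regression_mean /Ybar; congr (_ + _); lra.
rewrite max_gap_addl_cst// max_gapZ//.
rewrite (_ : Zreg C e = max_gap C (epsbar e))//.
by rewrite mulrAC divff ?mul1r// gt_eqF.
Qed.

End statistics_in_noise.

(** * Measurability *)

Section measurability.
Context {R : realType}.
Context d (T : measurableType d).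

(** A Lipschitz function is the infimum, over the rational points [q], of the
    cones [F q + L * |x - q|]; there are countably many of them. *)
Lemma measurable_fun_lipschitz m (F : ('I_m -> R) -> R) (L : R)
    (X : 'I_m -> T -> R) : 0 < L ->
  (forall u v, F u <= F v + L * \sum_(i < m) `|u i - v i|) ->
  (forall i, measurable_fun setT (X i)) ->
  measurable_fun setT (fun w => F (X ^~ w)).
Proof.
move=> L0 FL mX mT; apply: (measurability _ (RGenInftyO.measurableE R)) => //.
move=> /= _ [_ [c ->] <-]; rewrite setTI.
pose cone (q : {ffun 'I_m -> rat}) w : R :=
  F (fun i => ratr (q i)) + L * \sum_(i < m) `|X i w - ratr (q i)|.
rewrite [X in measurable X](_ : _ = \bigcup_q [set w | cone q w < c]).
  apply: countable_bigcupT_measurable => [|q]; first exact: countableP.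
  rewrite (_ : [set _ | _] = setT `&` cone q @^-1` `]-oo, c[); last first.
    by apply/seteqP; split => w /=; rewrite in_itv/=; tauto.
  have : measurable_fun setT (cone q).
    apply: measurable_funD => //; apply: measurable_funM => //.
    apply: measurable_sum => i; apply: measurableT_comp => //.
    exact: measurable_funB.
  by apply => //; exact: measurable_itv.
apply/seteqP; split=> [w|w [q _]] /=; rewrite in_itv/=; last first.
  by apply: le_lt_trans; exact: FL.
(* Moving each coordinate by at most [r] changes the value of the cone at [w]
   by at most [2 * L * m * r], which is less than [c - F]. *)
move=> Fc; pose r := (c - F (X ^~ w)) / (2 * L * m.+1%:R).
have r0 : 0 < r by rewrite divr_gt0 ?subr_gt0// !mulr_gt0.
have /choice[q qP] : forall i : 'I_m,
    exists q : rat, X i w < ratr q < X i w + r.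
  move=> i; have /rat_in_itvoo[q] : X i w < X i w + r by rewrite ltrDl.
  by rewrite inE => ?; exists q.
exists (finfun q) => //=; rewrite /cone.
pose S := \sum_(i < m) `|X i w - ratr (q i)|.
have SE : \sum_(i < m) `|X i w - ratr (finfun q i)| = S.
  by apply: eq_bigr => i _; rewrite ffunE.
have Sr : S <= m%:R * r.
  rewrite -[m in m%:R]card_ord mulr_natl -sumr_const; apply: ler_sum => i _.
  by rewrite distrC ger0_norm; have /andP[] := qP i; lra.
have := FL (fun i => ratr (finfun q i)) (X ^~ w).
rewrite (eq_bigr (fun i => `|X i w - ratr (finfun q i)|)); last first.
  by move=> i _; rewrite distrC.
rewrite SE => Fq.
have LS : L * S <= L * (m%:R * r) by rewrite ler_wpM2l// ltW.
have LSr : 2 * (L * (m%:R * r)) < c - F (X ^~ w).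
  rewrite (_ : c - _ = 2 * L * m.+1%:R * r); last first.
    by rewrite /r mulrC divfK// gt_eqF// !mulr_gt0.
  rewrite -natr1; have := mulr_gt0 L0 r0; lra.
lra.
Qed.

Lemma measurable_studentize k :
  measurable_fun setT (fun p : R * R => studentize k p.1 p.2).
Proof.
rewrite (_ : (fun p => _) =
    fun p : R * R => p.1 * (Num.sqrt (p.2 / k%:R)) `^ (-1)); last first.
  by apply/funext => p; rewrite /studentize powR_inv1// sqrtr_ge0.
apply: measurable_funM => //.
apply: (measurableT_comp (@measurable_powR _ _)) => //.
apply: (measurableT_comp (continuous_measurable_fun (@sqrt_continuous R))).
exact: measurable_funM.
Qed.

End measurability.

(** * The standard normal law *)

Definition image_measure d d' (T : measurableType d) (T' : measurableType d')
    (R : realType) (m : {measure set T -> \bar R}) (f : T -> T')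
    (mf : measurable_fun setT f) : {measure set T' -> \bar R} :=
  measure_function_pushforward__canonical__measure_function_Measure m mf.

Section affine_substitution.
Context {R : realType}.
Local Open Scope ereal_scope.
Local Notation mu := (@lebesgue_measure R).
Local Notation mR := (measurableTypeR R).

Lemma lebesgue_integral_affine (a b : R) (f : R -> \bar R) : (0 < a)%R ->
  measurable_fun setT f -> (forall x, 0 <= f x) ->
  \int[mu]_x f x = a%:E * \int[mu]_x f (a * x + b)%R.
Proof.
move=> a0 mf f0; pose phi (x : mR) : mR := (a * x + b)%R.
have mphi : measurable_fun setT phi.
  by apply: measurable_funD => //; exact: measurable_funM.
have a0' : (0 <= a)%R by exact: ltW.
have -> : \int[mu]_x f x =
    \int[mscale (NngNum a0') (image_measure mu mphi)]_x f x.
  apply: eq_measure_integral => A mA _ /=.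
  apply: lebesgue_measure_unique => // _ [[c d] _ <-]; rewrite /mscale/=.
  have phiE : phi @^-1` `]c, d] = `]((c - b) / a)%R, ((d - b) / a)%R]%classic.
    apply/seteqP; split => x; rewrite /= !in_itv/= /phi;
      by rewrite ltr_pdivrMr// ler_pdivlMr// ltrBlDr lerBrDr [(a * _)%R]mulrC.
  change (mu `]c, d] = a%:E * mu (phi @^-1` `]c, d])).
  rewrite phiE !lebesgue_measure_itv/= !lte_fin ltr_pM2r ?invr_gt0// ltrD2r.
  case: ifP => _; last by rewrite mule0.
  rewrite -!EFinB -EFinM; congr EFin; field; exact/lt0r_neq0.
rewrite ge0_integral_mscale//=; congr (_ * _).
by rewrite /image_measure/= ge0_integral_pushforward.
Qed.

Lemma lebesgue_integral_opp (f : R -> \bar R) :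
  measurable_fun setT f -> (forall x, 0 <= f x) ->
  \int[mu]_x f x = \int[mu]_x f (- x)%R.
Proof.
move=> mf f0.
have mN : measurable_fun setT (-%R : mR -> mR) by exact: oppr_measurable.
have -> : \int[mu]_x f x = \int[image_measure mu mN]_x f x.
  apply: eq_measure_integral => A mA _; rewrite -[LHS]lebesgue_measureN//.
by rewrite /image_measure/= ge0_integral_pushforward.
Qed.

End affine_substitution.

Section standard_normal_law.
Context {R : realType}.
Local Open Scope ereal_scope.
Local Notation mu := (@lebesgue_measure R).
Local Notation mR := (measurableTypeR R).
Local Notation phi := (@normal_pdf R 0 1).
Local Notation N := (@normal_prob R 0 1).

Let mphi : measurable_fun setT phi := measurable_normal_pdf 0 1.

Let phi_ge0 x : (0 <= phi x)%R := normal_pdf_ge0 0 1 x.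

Lemma normal_pdfE01 (x : R) :
  phi x = (normal_peak 1 * expR (- (x ^+ 2) / 2))%R.
Proof.
rewrite normal_pdfE ?oner_neq0// /normal_fun subr0 expr1n; congr (_ * expR _)%R.
Qed.

(** The normal density is a version of the Radon-Nikodym derivative, for which
    the change of variables is known. *)
Lemma integral_normal_prob (f : mR -> \bar R) : measurable_fun setT f ->
  (forall x, 0 <= f x <= 1) ->
  \int[N]_x f x = \int[mu]_x (f x * (phi x)%:E).
Proof.
move=> mf f01.
have fN : N.-integrable setT f.
  apply: (le_integrable measurableT mf (g := cst 1)).
    move=> x _; have /andP[f0 f1] := f01 x.
    by rewrite !gee0_abs//= lee_fin normr1 -lee_fin.
  exact: finite_measure_integrable_cst.
have dom := normal_prob_dominates 0 1 : N `<< mu.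
rewrite -(Radon_Nikodym_change_of_variables dom)//=.
apply: ae_eq_integral => //.
- by apply: emeasurable_funM => //; exact/measurable_EFinP.
- by apply: emeasurable_funM => //; exact/measurable_EFinP.
- apply: ae_eqe_mul2l => /=; apply: integral_ae_eq => //.
  + exact: Radon_Nikodym_integrable.
  + exact/measurable_EFinP.
  + by move=> E _ mE; rewrite -Radon_Nikodym_integral.
Qed.


Lemma normal_prob_indic (A : set mR) :
  N A = \int[mu]_x (\1_A x * phi x)%:E.
Proof.
rewrite /normal_prob [LHS]integral_mkcond; apply: eq_integral => x _.
by rewrite patchE indicE; case: ifPn => _; rewrite ?mul1r ?mul0r.
Qed.

(** Rotation by an eighth of a turn preserves the Lebesgue measure of the plane
    (each of the two affine substitutions acts on one coordinate) and the sum
    of squares in the exponent of the product density. *)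
Lemma normal_prob_rotation (A B : set mR) : measurable A -> measurable B ->
  (N \x N) [set p : mR * mR | A ((p.1 + p.2) / Num.sqrt 2)%R /\
                    B ((p.2 - p.1) / Num.sqrt 2)%R] = N A * N B.
Proof.
move=> mA mB; set D := [set p : mR * mR | _].
have q0 : (0 < Num.sqrt 2 :> R)%R by rewrite sqrtr_gt0.
have q2 : (Num.sqrt 2 ^+ 2 = 2 :> R)%R by rewrite sqr_sqrtr.
move: (Num.sqrt 2) q0 q2 @D => q q0 q2 D.
have qn0 : q != 0%R by rewrite gt_eqF.
pose G (p : mR * mR) : R :=
  (\1_A ((p.1 + p.2) / q) * \1_B ((p.2 - p.1) / q) * (phi p.1 * phi p.2))%R.
have mcomp (f : mR -> R) d (T : measurableType d) (g : T -> mR) :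
    measurable_fun setT f -> measurable_fun setT g ->
    measurable_fun setT (fun x => f (g x)) by exact: measurableT_comp.
have mD : measurable D.
  have m1 : measurable_fun setT (fun p : mR * mR => ((p.1 + p.2) / q)%R : mR).
    by apply: measurable_funM => //; exact: measurable_funD.
  have m2 : measurable_fun setT (fun p : mR * mR => ((p.2 - p.1) / q)%R : mR).
    by apply: measurable_funM => //; exact: measurable_funB.
  by apply: measurableI; rewrite -[X in measurable X]setTI;
    [exact: m1|exact: m2].
have mG : measurable_fun setT G.
  apply: measurable_funM; apply: measurable_funM.
  - apply: mcomp; first exact: measurable_indic.
    by apply: measurable_funM => //; exact: measurable_funD.
  - apply: mcomp; first exact: measurable_indic.
    by apply: measurable_funM => //; exact: measurable_funB.
  - by apply: mcomp.
  - by apply: mcomp.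
have G0 p : (0 <= G p)%R by rewrite !mulr_ge0.
have EG0 p : 0 <= (G p)%:E by rewrite lee_fin.
transitivity (\int[mu]_x \int[mu]_y (G (x, y))%:E).
  rewrite /product_measure1 integral_normal_prob; last 2 first.
  - exact: measurable_fun_xsection.
  - move=> x; rewrite measure_ge0/= probability_le1//.
    exact: measurable_xsection.
  apply: eq_integral => x _; rewrite /= normal_prob_indic.
  rewrite -ge0_integralZr//=.
  - apply: eq_integral => y _; rewrite -EFinM /G; congr EFin.
    rewrite [\1_(xsection _ _) y](_ : _ =
      \1_A ((x + y) / q) * \1_B ((y - x) / q))%R; first by ring.
    rewrite !indicE -natrM mulnb; congr (nat_of_bool _)%:R.
    rewrite mem_xsection /D; apply/idP/andP.
      by move=> /set_mem[/= Au Bw]; split; exact: mem_set.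
    by move=> [/set_mem Au /set_mem Bw]; apply: mem_set.
  - apply/measurable_EFinP; apply: measurable_funM => //.
    exact/measurable_indic/measurable_xsection.
  - by move=> y _; rewrite lee_fin mulr_ge0.
  - by rewrite lee_fin.
(* Substitution [y = q * u - x], for fixed [x]. *)
pose K (p : mR * mR) : \bar R := (q * G (p.1, q * p.2 - p.1))%:E.
have mK : measurable_fun setT K.
  apply/measurable_EFinP; apply: measurable_funM => //.
  apply: (measurableT_comp mG); apply: measurable_fun_pair => //.
  by apply: measurable_funB => //; exact: measurable_funM.
have K0 p : 0 <= K p by rewrite lee_fin mulr_ge0// ltW.
transitivity (\int[mu]_x \int[mu]_u K (x, u)).
  apply: eq_integral => x _.
  have mGx : measurable_fun setT (fun y => (G (x, y))%:E).
    by apply/measurable_EFinP; apply: (measurableT_comp mG).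
  rewrite (lebesgue_integral_affine (- x) q0 mGx)//.
  rewrite -ge0_integralZl//; last by rewrite lee_fin ltW.
  by apply: (measurableT_comp mGx); apply: measurable_funD => //;
    exact: measurable_funM.
(* After exchanging the integrals, substitution [x = (u - w) / q] for fixed
   [u]. *)
rewrite fubini_tonelli//.
transitivity (\int[mu]_u \int[mu]_w (\1_A u * phi u * (\1_B w * phi w))%:E).
  apply: eq_integral => u _.
  have mKu : measurable_fun setT (fun x => K (x, u)).
    by apply: (measurableT_comp mK).
  have q1 : (0 < q^-1)%R by rewrite invr_gt0.
  have maff : measurable_fun setT (fun w : mR => (q^-1 * w + u / q)%R : mR).
    by apply: measurable_funD => //; exact: measurable_funM.
  have mKaff : measurable_fun setT (fun w : mR => K ((q^-1 * w + u / q)%R, u)).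
    exact: (measurableT_comp mKu maff).
  have mN : measurable_fun setT (-%R : mR -> mR) by exact: oppr_measurable.
  rewrite (lebesgue_integral_affine (u / q) q1 mKu (fun=> K0 _)).
  rewrite (lebesgue_integral_opp mKaff (fun=> K0 _)).
  rewrite -ge0_integralZl//; last 2 first.
  - exact: (measurableT_comp mKaff mN).
  - by rewrite lee_fin ltW.
  apply: eq_integral => w _; rewrite /K /G/= -EFinM mulKf//; congr EFin.
  set x := (q^-1 * - w + u / q)%R.
  have q1E : (2 * q^-1 = q)%R by rewrite -q2; field.
  have q1q1 : (2 * q^-1 * q^-1 = 1)%R by rewrite q1E divff.
  have qu : (q * u = 2 * q^-1 * u)%R by rewrite q1E.
  have -> : ((x + (q * u - x)) / q = u)%R by rewrite /x; field.
  have -> : ((q * u - x - x) / q = w)%R.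
    transitivity (w * (2 * q^-1 * q^-1))%R; last by rewrite q1q1 mulr1.
    by rewrite qu /x; ring.
  rewrite [RHS]mulrACA; congr (_ * _)%R.
  rewrite !normal_pdfE01 mulrACA [RHS]mulrACA -!expRD; congr (_ * expR _)%R.
  transitivity ((- u ^+ 2 / 2 + - w ^+ 2 / 2) * (2 * q^-1 * q^-1))%R.
    by rewrite qu /x; field.
  by rewrite q1q1 mulr1.
have mphi1 (D' : set mR) : measurable D' ->
    measurable_fun setT (fun w : mR => (\1_D' w * phi w)%:E).
  by move=> mD'; apply/measurable_EFinP; exact: measurable_funM.
have phi1_ge0 (D' : set mR) w : 0 <= (\1_D' w * phi w)%:E.
  by rewrite lee_fin mulr_ge0.
transitivity (\int[mu]_u ((\1_A u * phi u)%:E * N B)).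
  apply: eq_integral => u _; rewrite normal_prob_indic -ge0_integralZl//.
  exact: mphi1.
rewrite ge0_integralZr//; last exact: mphi1.
by rewrite -normal_prob_indic.
Qed.

End standard_normal_law.

Section measurable_sets.
Context d (T : measurableType d).

Lemma measurable_preimageT d' (T' : measurableType d') (f : T -> T')
    (A : set T') :
  measurable_fun setT f -> measurable A -> measurable (f @^-1` A).
Proof. by move=> mf mA; rewrite -[X in measurable X]setTI; exact: mf. Qed.

Lemma measurable_set_lt (R : realType) (f g : T -> R) :
  measurable_fun setT f -> measurable_fun setT g ->
  measurable [set x | f x < g x].
Proof.
move=> mf mg.
exact: (measurable_preimageT (measurable_fun_ltr mf mg) (A := [set true])).
Qed.

Lemma measurable_set_le (R : realType) (f g : T -> R) :
  measurable_fun setT f -> measurable_fun setT g ->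
  measurable [set x | f x <= g x].
Proof.
move=> mf mg.
exact: (measurable_preimageT (measurable_fun_ler mf mg) (A := [set true])).
Qed.

End measurable_sets.

Section standard_normal_small_balls.
Context {R : realType}.
Local Open Scope ereal_scope.
Local Notation mu := (@lebesgue_measure R).
Local Notation mR := (measurableTypeR R).
Local Notation phi := (@normal_pdf R 0 1).
Local Notation N := (@normal_prob R 0 1).

Let phi_anti (x y : R) : (`|x| <= `|y|)%R -> (phi y <= phi x)%R.
Proof.
move=> xy; rewrite !normal_pdfE01 ler_wpM2l ?normal_peak_ge0//.
by rewrite ler_expR ler_wpM2r// lerN2 -(real_normK (num_real x))
  -(real_normK (num_real y)) lerXn2r ?nnegrE.
Qed.

Let measurable_ball (a b : R) : measurable [set x : mR | `|x + b| < a]%R.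
Proof.
by apply: measurable_set_lt => //; apply: measurableT_comp => //;
  exact: measurable_funD.
Qed.

(** Anderson's inequality in dimension one, by rearrangement: the reflection
    [x |-> - b - x] exchanges the two intervals, and where only one of them
    contains [x], the density is larger at whichever of [x] and its mirror
    image lies in the centered interval. *)
Lemma normal_prob_ball_shift (a b : R) :
  N [set x | `|x + b| < a]%R <= N [set x | `|x| < a]%R.
Proof.
set J := [set x : mR | `|x + b| < a]%R; set I := [set x : mR | `|x| < a]%R.
have mJ : measurable J by exact: measurable_ball.
have mI : measurable I.
  rewrite (_ : I = [set x : mR | `|x + 0| < a]%R); first exact: measurable_ball.
  by apply/seteqP; split => x /=; rewrite addr0.
pose r (x : mR) : mR := (- x - b)%R.
have rJ x : \1_J (r x) = \1_I x :> R.
  by rewrite !indicE; congr (nat_of_bool _)%:R; apply/idP/idP => /set_mem xI;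
    apply/mem_set; move: xI; rewrite /J /I/= /r subrK normrN.
have rI x : \1_I (r x) = \1_J x :> R.
  by rewrite !indicE; congr (nat_of_bool _)%:R; apply/idP/idP => /set_mem xI;
    apply/mem_set; move: xI; rewrite /J /I/= /r -opprD normrN.
have mr : measurable_fun setT r.
  by apply: measurable_funB => //; exact: oppr_measurable.
have mphi : measurable_fun setT (phi : mR -> R) := measurable_normal_pdf 0 1.
have m1 (A : set mR) : measurable A ->
    measurable_fun setT (fun w : mR => (\1_A w * phi w)%:E).
  by move=> mA; apply/measurable_EFinP; exact: measurable_funM.
have m2 (A : set mR) : measurable A ->
    measurable_fun setT (fun w : mR => (\1_A w * phi (r w))%:E).
  move=> mA; apply/measurable_EFinP; apply: measurable_funM => //.
  exact: (measurableT_comp mphi mr).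
have ge1 (A : set mR) w : 0 <= (\1_A w * phi w)%:E.
  by rewrite lee_fin mulr_ge0 ?normal_pdf_ge0.
have ge2 (A : set mR) w : 0 <= (\1_A w * phi (r w))%:E.
  by rewrite lee_fin mulr_ge0 ?normal_pdf_ge0.
have reflect (A : set mR) : measurable A ->
    N A = \int[mu]_x (\1_A (r x) * phi (r x))%:E.
  move=> mA; rewrite normal_prob_indic.
  rewrite (lebesgue_integral_affine (- b) ltr01 (m1 _ mA) (ge1 A)) mul1e.
  have maff : measurable_fun setT (fun x : mR => (1 * x - b)%R : mR).
    by apply: measurable_funB => //; exact: measurable_funM.
  rewrite (lebesgue_integral_opp (measurableT_comp (m1 _ mA) maff)
    (fun=> ge1 A _)).
  by apply: eq_integral => x _; rewrite /= mul1r.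
have JE : \int[mu]_x (\1_I x * phi (r x))%:E = N J.
  by rewrite reflect//; apply: eq_integral => x _; rewrite rJ.
have IE : \int[mu]_x (\1_J x * phi (r x))%:E = N I.
  by rewrite reflect//; apply: eq_integral => x _; rewrite rI.
(* Adding the mirrored integrals makes the comparison pointwise. *)
have : N J + N J <= N I + N I.
  rewrite -{2}JE -{2}IE !normal_prob_indic -!ge0_integralD//;
    try (by apply: m1); try (by apply: m2).
  apply: ge0_le_integral => //.
  - by move=> x _; apply: adde_ge0; [exact: ge1|exact: ge2].
  - by apply: emeasurable_funD; [exact: m1|exact: m2].
  - by apply: emeasurable_funD; [exact: m1|exact: m2].
  move=> x _; rewrite -!EFinD lee_fin !indicE.
  have [xJ|xJ] := boolP (x \in J); have [xI|xI] := boolP (x \in I);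
    rewrite ?mul1r ?mul0r ?addr0 ?add0r//.
  - apply: phi_anti; rewrite /r -opprD normrN.
    move: xJ xI => /set_mem /= xJ; rewrite notin_setE/= => /negP.
    by rewrite -leNgt => xI; exact: ltW (lt_le_trans xJ xI).
  - apply: phi_anti; rewrite /r -opprD normrN.
    move: xI xJ => /set_mem /= xI; rewrite notin_setE/= => /negP.
    by rewrite -leNgt => xJ; exact: ltW (lt_le_trans xI xJ).
have fin (A : set mR) : measurable A -> N A \is a fin_num.
  by move=> mA; exact: fin_num_measure.
by rewrite -(fineK (fin _ mI)) -(fineK (fin _ mJ)) -!EFinD !lee_fin; lra.
Qed.

Lemma normal_prob_set1 (x : R) : N [set x] = 0.
Proof.
have /null_content_dominatesP := normal_prob_dominates 0 1 : N `<< mu.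
by apply => //; exact: lebesgue_measure_set1.
Qed.

Lemma normal_prob_sqr_eq (c : R) : N [set x | x ^+ 2 = c]%R = 0.
Proof.
apply: (@subset_measure0 _ _ _ N _
  ([set Num.sqrt c] `|` [set (- Num.sqrt c)%R])).
- have mX : measurable_fun setT (fun x : mR => (x ^+ 2)%R : mR).
    exact: measurable_funX.
  exact: (measurable_preimageT mX (A := [set c])).
- exact: measurableU.
- move=> x /= <-; rewrite sqrtr_sqr.
  have [x0|x0] := leP 0%R x; first by left; rewrite ger0_norm.
  by right; rewrite ltr0_norm// opprK.
- apply/eqP; rewrite -measure_le0; apply: le_trans (measureU2 _ _ _) _ => //.
  by rewrite /= !normal_prob_set1 adde0.
Qed.

End standard_normal_small_balls.

(** * Chi-square laws *)

Section noncentral_chi2.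
Context {R : realType}.
Local Open Scope ereal_scope.
Local Notation mR := (measurableTypeR R).
Local Notation N := (@normal_prob R 0 1 : probability mR R).

Definition add_shifted_sqr (c : R) (x : mR * mR) : mR :=
  (x.1 + (x.2 + c) ^+ 2)%R.

Lemma measurable_add_shifted_sqr c : measurable_fun setT (add_shifted_sqr c).
Proof.
apply: measurable_funD => //; apply: measurable_funX.
exact: measurable_funD.
Qed.

HB.instance Definition _ c := isMeasurableFun.Build _ _ (mR * mR)%type mR
  (add_shifted_sqr c) (measurable_add_shifted_sqr c).

(** The law of the sum of the squares of [x_i + b i], for independent standard
    normal [x_i], built by the recursion that defines [chi2] so that the two
    are compared one square at a time. *)
Fixpoint noncentral_chi2 (b : nat -> R) (k : nat) : probability mR R :=
  if k is k'.+1 then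
    distribution (noncentral_chi2 b k' \x N) (add_shifted_sqr (b k'))
  else dirac (0%R : mR).

Lemma product_prob_ysection d1 d2 (T1 : measurableType d1)
    (T2 : measurableType d2) (P1 : probability T1 R) (P2 : probability T2 R)
    (D : set (T1 * T2)) : measurable D ->
  (P1 \x P2) D = \int[P2]_y P1 (ysection D y).
Proof.
move=> mD; transitivity ((P1 \x^ P2) D); last by [].
by apply: product_measure_unique => //= A B mA mB; rewrite product_measure2E.
Qed.

Lemma product_prob_xsection_eq0 d1 d2 (T1 : measurableType d1)
    (T2 : measurableType d2) (P1 : probability T1 R) (P2 : probability T2 R)
    (D : set (T1 * T2)) : (forall x, P2 (xsection D x) = 0) ->
  (P1 \x P2) D = 0.
Proof. by move=> D0; rewrite /product_measure1/= integral0_eq. Qed.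

Lemma product_prob_xsection_le d1 d2 (T1 : measurableType d1)
    (T2 : measurableType d2) (P1 : probability T1 R) (P2 Q2 : probability T2 R)
    (D : set (T1 * T2)) : measurable D ->
    (forall x, P2 (xsection D x) <= Q2 (xsection D x)) ->
  (P1 \x P2) D <= (P1 \x Q2) D.
Proof.
move=> mD PQ; rewrite /product_measure1/=; apply: ge0_le_integral => //.
- exact: measurable_fun_xsection.
- exact: measurable_fun_xsection.
Qed.

Lemma product_prob_ysection_le d1 d2 (T1 : measurableType d1)
    (T2 : measurableType d2) (P1 Q1 : probability T1 R) (P2 : probability T2 R)
    (D : set (T1 * T2)) : measurable D ->
    (forall y, P1 (ysection D y) <= Q1 (ysection D y)) ->
  (P1 \x P2) D <= (Q1 \x P2) D.
Proof.
move=> mD PQ; rewrite !product_prob_ysection//; apply: ge0_le_integral => //.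
- exact: measurable_fun_ysection.
- exact: measurable_fun_ysection.
Qed.

Let measurable_lt (v : R) : measurable [set x : mR | (x < v)%R].
Proof. by apply: measurable_set_lt. Qed.

(** A shift makes each square stochastically larger: the inner integral is
    compared first for the last square, given the other ones, then for the
    other ones, given the last. *)
Lemma noncentral_chi2_lt (b : nat -> R) (k : nat) (v : R) :
  noncentral_chi2 b k [set x | (x < v)%R] <= chi2 k [set x | (x < v)%R].
Proof.
elim: k v => [//|k IH] v /=.
rewrite /distribution /pushforward.
set D := add_shifted_sqr (b k) @^-1` _.
set D0 := add_sqr @^-1` _.
have mD : measurable D.
  by apply: measurable_preimageT => //; exact: measurable_add_shifted_sqr.
have mD0 : measurable D0.
  by apply: measurable_preimageT => //; exact: measurable_add_sqr.
have ball (g : mR -> R) u : [set y : mR | (g y ^+ 2 < u)%R] =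
    [set y : mR | (`|g y| < Num.sqrt u)%R].
  apply/seteqP; split=> y /=.
    by move=> yu; rewrite -sqrtr_sqr ltr_sqrt// (le_lt_trans _ yu)// sqr_ge0.
  have [u0|u0] := leP u 0%R; first by rewrite ler0_sqrtr// normr_lt0.
  by rewrite -sqrtr_sqr ltr_sqrt.
apply: (@le_trans _ _ ((noncentral_chi2 b k \x N) D0)).
  rewrite /product_measure1/=; apply: ge0_le_integral => //.
  - exact: measurable_fun_xsection.
  - exact: measurable_fun_xsection.
  move=> x _ /=.
  have -> : xsection D x = [set y : mR | ((y + b k) ^+ 2 < v - x)%R].
    by apply/seteqP; split=> y; rewrite /xsection/= inE/= ltrBrDl.
  have -> : xsection D0 x = [set y : mR | (y ^+ 2 < v - x)%R].
    by apply/seteqP; split=> y; rewrite /xsection/= inE/= ltrBrDl.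
  rewrite (ball (fun y => y + b k)%R) (ball id).
  exact: normal_prob_ball_shift.
apply: product_prob_ysection_le => // y.
have -> : ysection D0 y = [set x : mR | (x < v - y ^+ 2)%R].
  by apply/seteqP; split=> x; rewrite /ysection/= inE/= ltrBrDr.
exact: IH.
Qed.

Lemma chi2_set1 (k : nat) (c : R) : (0 < k)%N -> chi2 k [set c] = 0.
Proof.
case: k => // k _; rewrite /= /distribution /pushforward.
apply: product_prob_xsection_eq0 => x.
rewrite (_ : xsection _ _ = [set y : mR | y ^+ 2 = c - x]%R).
  exact: normal_prob_sqr_eq.
apply/seteqP; split=> y; rewrite /xsection/= inE/= /add_sqr/=.
  by move=> <-; rewrite addrAC subrr add0r.
by move=> ->; rewrite addrC subrK.
Qed.

Lemma chi2_lt0 (k : nat) : chi2 k [set x : mR | (x < 0)%R] = 0.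
Proof.
elim: k => [|k IH] /=.
  by rewrite diracE memNset//= ltxx.
rewrite /distribution /pushforward.
have mD : measurable (add_sqr @^-1` [set x : mR | (x < 0)%R]).
  by apply: measurable_preimageT => //; exact: measurable_add_sqr.
have mX : measurable ([set x : mR | (x < 0)%R] `*` [set: mR]).
  exact: measurableX.
apply: (subset_measure0 mD mX).
  move=> -[x y] /=; rewrite /add_sqr/= => xy; split => //.
  by apply: le_lt_trans xy; rewrite lerDl sqr_ge0.
by rewrite /= product_measure1E//= [X in X * _]IH mul0e.
Qed.

Lemma chi2_le0 (k : nat) : (0 < k)%N -> chi2 k [set x : mR | (x <= 0)%R] = 0.
Proof.
move=> k0; apply/eqP; rewrite -measure_le0.
have -> : [set x : mR | (x <= 0)%R] = [set x : mR | (x < 0)%R] `|` [set 0%R].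
  apply/seteqP; split=> x /=; rewrite le_eqVlt.
    by move=> /orP[/eqP|]; [right|left].
  by move=> [->|->]; rewrite ?orbT ?eqxx.
apply: le_trans (measureU2 _ _ _) _ => //.
by rewrite [X in X + _]chi2_lt0 [X in _ + X]chi2_set1// adde0.
Qed.

End noncentral_chi2.

(** * Extending independence from generators *)

Section independence.
Context d (T : measurableType d) (R : realType) (P : probability T R).
Local Open Scope ereal_scope.
Local Notation mR := (measurableTypeR R).
Local Notation N := (@normal_prob R 0 1 : probability mR R).

(** Independence of an event and a random variable of known law is decided on
    a pi-system that generates the values. *)
Lemma indep_event_generators d' (S : measurableType d') (G : set (set S))
    (X : T -> S) (Q : probability S R) (O : set T) :
    measurable = <<s G >> -> setI_closed G -> G setT ->
    measurable_fun setT X -> measurable O ->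
    (forall E, G E -> P (O `&` X @^-1` E) = P O * Q E) ->
  forall E, measurable E -> P (O `&` X @^-1` E) = P O * Q E.
Proof.
move=> mG GI GT mX mO PG E mE.
have PO : P O \is a fin_num by exact: fin_num_measure.
have PO0 : (0 <= fine (P O))%R by rewrite fine_ge0.
pose m1 : {measure set S -> \bar R} := image_measure (mrestr P mO) mX.
pose m2 : {measure set S -> \bar R} := mscale (NngNum PO0) Q.
have m1E A : m1 A = P (O `&` X @^-1` A).
  by rewrite /m1 /image_measure/= /pushforward /mrestr setIC.
have m2E A : m2 A = P O * Q A by rewrite /m2/= /mscale/= fineK.
rewrite -m1E -m2E; apply: (measure_unique G (fun=> setT)) => //.
- by rewrite bigcup_const//; exists 0%N.
- by move=> A GA; rewrite m1E m2E PG.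
- move=> _; rewrite m1E (le_lt_trans (probability_le1 _ _)) ?ltry//.
  by rewrite preimage_setT setIT.
Qed.

Lemma measurable_prod_generators d1 d2 (S1 : measurableType d1)
    (S2 : measurableType d2) :
  let G := [set D : set (S1 * S2) | exists A B,
    [/\ measurable A, measurable B & D = A `*` B]] in
  [/\ measurable = <<s G >>, setI_closed G & G setT].
Proof.
move=> G; split.
- rewrite measurable_prod_measurableType; congr (<<s _ >>).
  apply/seteqP; split=> D /=.
    by move=> [A mA [B mB <-]]; exists A, B.
  by move=> [A [B [mA mB ->]]]; exists A => //; exists B.
- move=> _ _ [A [B [mA mB ->]]] [A' [B' [mA' mB' ->]]].
  by exists (A `&` A'), (B `&` B'); rewrite -setXI;
    split => //; exact: measurableI.
- by exists setT, setT; split => //; rewrite setXTT.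
Qed.

Lemma indep_event_pair d1 d2 (S1 : measurableType d1) (S2 : measurableType d2)
    (X : T -> S1) (Y : T -> S2) (Q1 : probability S1 R) (Q2 : probability S2 R)
    (O : set T) :
    measurable_fun setT X -> measurable_fun setT Y -> measurable O ->
    (forall A B, measurable A -> measurable B ->
      P (O `&` [set w | A (X w) /\ B (Y w)]) = P O * (Q1 A * Q2 B)) ->
  forall D, measurable D ->
    P (O `&` [set w | D (X w, Y w)]) = P O * (Q1 \x Q2) D.
Proof.
move=> mX mY mO PAB.
have [mG GI GT] := measurable_prod_generators S1 S2.
apply: (indep_event_generators mG GI GT (X := fun w => (X w, Y w))) => //.
  exact: measurable_fun_pair.
by move=> _ [A [B [mA mB ->]]]; rewrite /= product_measure1E// -PAB.
Qed.

(** Mutual independence extends from a generating pi-system to the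
    sigma-algebra, one variable at a time. *)
Lemma mutual_indep_generators d' (S : measurableType d') (G : set (set S))
    (I : finType) (Z : I -> T -> S) (Q : probability S R) :
    measurable = <<s G >> -> setI_closed G -> G setT ->
    (forall i, measurable_fun setT (Z i)) ->
    (forall D, (forall i, G (D i)) ->
      P [set w | forall i, D i (Z i w)] = \prod_i Q (D i)) ->
  forall D, (forall i, measurable (D i)) ->
    P [set w | forall i, D i (Z i w)] = \prod_i Q (D i).
Proof.
move=> mG GI GT mZ PG.
have GM : G `<=` measurable by rewrite mG; exact: sub_sigma_algebra.
suff H (s : seq I) (D : I -> set S) : (forall i, measurable (D i)) ->
    (forall i, i \notin s -> G (D i)) ->
    P [set w | forall i, D i (Z i w)] = \prod_i Q (D i).
  by move=> D mD; apply: (H (enum I)) => // i; rewrite mem_enum.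
elim: s D => [|i0 s IH] D mD GD; first by apply: PG => i; exact: GD.
pose upd E i := if i == i0 then E else D i.
pose O := [set w | forall i, upd setT i (Z i w)].
have mupd E : measurable E -> forall i, measurable (upd E i).
  by move=> mE i; rewrite /upd; case: ifP.
have mcap (F : I -> set S) : (forall i, measurable (F i)) ->
    measurable [set w | forall i, F i (Z i w)].
  move=> mF; rewrite (_ : [set _ | _] = \big[setI/setT]_i (Z i @^-1` F i)).
    by apply: bigsetI_measurable => i _; exact: measurable_preimageT.
  rewrite -bigcap_seq; apply/seteqP; split=> w /= Fw i.
    by move=> _; exact: Fw.
  by apply: Fw => /=; rewrite mem_index_enum.
have OE E : O `&` Z i0 @^-1` E = [set w | forall i, upd E i (Z i w)].
  apply/seteqP; split=> w /=.
    move=> [Ow Ew] i; have := Ow i; rewrite /upd.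
    by case: eqP => // ->.
  move=> Uw; split; last by have := Uw i0; rewrite /upd eqxx.
  by move=> i; have := Uw i; rewrite /upd; case: eqP.
have PU E : G E -> P (O `&` Z i0 @^-1` E) = \prod_i Q (upd E i).
  move=> GE; rewrite OE; apply: IH; first by apply: mupd; exact: GM.
  move=> i si; rewrite /upd; case: eqP => // /eqP ii0.
  by apply: GD; rewrite inE negb_or ii0.
have prodU E : \prod_i Q (upd E i) = \prod_(i | i != i0) Q (D i) * Q E.
  rewrite (bigD1 i0)//= /upd eqxx muleC; congr (_ * _).
  by apply: eq_bigr => i /negbTE ->.
have PO : P O = \prod_(i | i != i0) Q (D i).
  have := PU setT GT; rewrite preimage_setT setIT prodU => ->.
  by rewrite probability_setT mule1.
have := indep_event_generators mG GI GT (mZ i0) (mcap _ (mupd _ measurableT))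
  (Q := Q) _ (mD i0).
rewrite OE -/O PO (_ : upd (D i0) = D); last first.
  by apply/funext => i; rewrite /upd; case: eqP => // ->.
move=> ->; last by move=> E GE; rewrite PU// prodU.
by rewrite -prodU; apply: eq_bigr => i _; rewrite /upd; case: eqP => // ->.
Qed.

End independence.

(** * Independence of pairwise sums and differences *)

Section rotated_noise.
Context d (T : measurableType d) (R : realType) (P : probability T R).
Context (n : nat) (eps : 'I_n -> {RV P >-> R}).
Hypotheses (n_even : ~~ odd n)
  (eps_normal : forall i, standard_normal (eps i))
  (eps_indep : independent_RVs eps).
Local Open Scope ereal_scope.
Local Notation mR := (measurableTypeR R).
Local Notation N := (@normal_prob R 0 1 : probability mR R).
Local Notation k := n./2.

Let e (w : T) : 'I_n -> R := eps ^~ w.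

Let meps i : measurable_fun setT (eps i : T -> mR).
Proof. exact: (@measurable_funPT _ _ _ _ (eps i)). Qed.

Lemma prod_pairs (F : 'I_n -> \bar R) :
  \prod_j F j = \prod_(i < k) (F (pair_fst i) * F (pair_snd i)).
Proof.
pose h (p : 'I_k * bool) := if p.2 then pair_snd p.1 else pair_fst p.1.
have hinj : injective h.
  move=> [i [|]] [j [|]] /(congr1 (@nat_of_ord _)) /=; rewrite /h/=.
  - by move=> [] /double_inj /ord_inj ->.
  - by move=> ij; have := congr1 odd ij; rewrite /= !odd_double.
  - by move=> ij; have := congr1 odd ij; rewrite /= !odd_double.
  - by move=> /double_inj /ord_inj ->.
have hbij : bijective h.
  apply: inj_card_bij => //; rewrite card_prod card_bool !card_ord.
  by rewrite muln2 even_halfK.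
rewrite (reindex h)/=; last exact: onW_bij.
rewrite -(pair_bigA _ (fun i b => F (h (i, b))))/=.
by apply: eq_bigr => i _; rewrite big_bool/= muleC.
Qed.

Let eps_joint (A : 'I_n -> set R) : (forall i, measurable (A i)) ->
  P [set w | forall i, A i (eps i w)] = \prod_i N (A i).
Proof.
move=> mA; have := eps_indep (finset.setT : {set 'I_n}) mA.
rewrite (_ : \bigcap_(i in _) _ = [set w | forall i, A i (eps i w)]);
    last first.
  apply/seteqP; split=> w /= Aw i; first by apply: (Aw i); rewrite /= inE.
  by move=> _; exact: Aw.
move=> ->; rewrite big_set/=; apply: eq_bigr => i _.
exact: eps_normal.
Qed.

Let pair_joint (D : 'I_k -> set (mR * mR)) : (forall i, measurable (D i)) ->
  P [set w | forall i, D i (eps (pair_fst i) w, eps (pair_snd i) w)] =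
  \prod_i (N \x N) (D i).
Proof.
have [mG GI GT] := measurable_prod_generators mR mR.
pose Z (i : 'I_k) w : mR * mR := (eps (pair_fst i) w, eps (pair_snd i) w).
move: D; apply: (mutual_indep_generators (Z := Z) (Q := N \x N) mG GI GT).
  by move=> i; exact: measurable_fun_pair.
move=> D /choice[A] /choice[B] DAB.
(* The event of position [j] is the one that its pair imposes on it: [A] on the
   first position of the pair, [B] on the second. *)
pose F (j : 'I_n) : set mR :=
  oapp (if odd j then B else A) setT (insub (j./2) : option 'I_k).
have Ffst i : F (pair_fst i) = A i.
  by rewrite /F/= odd_double doubleK valK.
have Fsnd i : F (pair_snd i) = B i.
  by rewrite /F/= odd_double uphalf_double valK.
have mF j : measurable (F j).
  rewrite /F; case: insub => [i|] //=.
  by case: ifP => _; have [] := DAB i.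
transitivity (P [set w | forall j, F j (eps j w)]).
  congr (P _); apply/seteqP; split=> w /= Dw.
    move=> j; have [jk|jk] := ltnP j./2 k.
      have := Dw (Ordinal jk); have [_ _ ->] := DAB (Ordinal jk).
      rewrite /Z -Ffst -Fsnd => -[/= F1 F2].
      have [jodd|jeven] := boolP (odd j).
        by rewrite (_ : j = pair_snd (Ordinal jk))//; apply: val_inj => /=;
          rewrite -[LHS]odd_double_half jodd.
      by rewrite (_ : j = pair_fst (Ordinal jk))//; apply: val_inj => /=;
        rewrite -[LHS]odd_double_half (negbTE jeven).
    by rewrite /F insubN// -leqNgt.
  move=> i; have [_ _ ->] := DAB i; split=> /=.
    by rewrite -Ffst; exact: Dw.
  by rewrite -Fsnd; exact: Dw.
rewrite eps_joint// prod_pairs; apply: eq_bigr => i _.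
have [mA mB ->] := DAB i.
by rewrite /= product_measure1E// Ffst Fsnd.
Qed.

(** A rectangle for the rotated pairs is a product of rotated rectangles, one
    for each pair, and the pairs are independent. *)
Lemma rotated_noise_joint (A B : 'I_k -> set mR) :
    (forall i, measurable (A i)) -> (forall i, measurable (B i)) ->
  P [set w | forall i, A i (epsbar (e w) i) /\ B i (epsdiff (e w) i)] =
  \prod_i (N (A i) * N (B i)).
Proof.
move=> mA mB.
pose D (i : 'I_k) := [set p : mR * mR |
  A i ((p.1 + p.2) / Num.sqrt 2)%R /\ B i ((p.2 - p.1) / Num.sqrt 2)%R].
rewrite (_ : [set w | _] =
  [set w | forall i, D i (eps (pair_fst i) w, eps (pair_snd i) w)])//.
rewrite pair_joint; last first.
  move=> i; have m1 : measurable_fun setT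
      (fun p : mR * mR => ((p.1 + p.2) / Num.sqrt 2)%R : mR).
    by apply: measurable_funM => //; exact: measurable_funD.
  have m2 : measurable_fun setT
      (fun p : mR * mR => ((p.2 - p.1) / Num.sqrt 2)%R : mR).
    by apply: measurable_funM => //; exact: measurable_funB.
  by apply: measurableI;
    [exact: (measurable_preimageT m1)|exact: (measurable_preimageT m2)].
by apply: eq_bigr => i _; exact: normal_prob_rotation.
Qed.

Lemma measurable_epsbar i : measurable_fun setT (fun w => epsbar (e w) i : mR).
Proof.
by apply: measurable_funM => //; apply: measurable_funD; exact: meps.
Qed.

Lemma measurable_epsdiff i :
  measurable_fun setT (fun w => epsdiff (e w) i : mR).
Proof.
by apply: measurable_funM => //; apply: measurable_funB; exact: meps.
Qed.

End rotated_noise.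

(** * The joint law of the numerator and of the sum of squares *)

Section sum_of_squares_law.
Context d (T : measurableType d) (R : realType) (P : probability T R).
Local Open Scope ereal_scope.
Local Notation mR := (measurableTypeR R).
Local Notation N := (@normal_prob R 0 1 : probability mR R).

(** The squares are added one at a time: at stage [m], the event [O], the sum
    of the first [m] squares and the remaining variables are independent. *)
Lemma indep_event_sum_sqr k (W : 'I_k -> T -> mR) (b : nat -> R) (O : set T) :
    (forall i, measurable_fun setT (W i)) -> measurable O ->
    (forall B : 'I_k -> set mR, (forall i, measurable (B i)) ->
      P (O `&` [set w | forall i, B i (W i w)]) = P O * \prod_i N (B i)) ->
  forall D : set mR, measurable D ->
    P (O `&` [set w | D (\sum_(i < k) (W i w + b i) ^+ 2)%R]) =
    P O * noncentral_chi2 b k D.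
Proof.
move=> mW mO PB.
pose V m w : mR := (\sum_(i < k | (i < m)%N) (W i w + b i) ^+ 2)%R.
have mV m : measurable_fun setT (V m).
  rewrite /V; under eq_fun do rewrite big_mkcond/=.
  apply: measurable_sum => i /=; case: (i < m)%N => //.
  apply: (measurable_funX (f := fun w => (W i w + b i)%R)).
  by apply: measurable_funD => //; exact: mW.
pose tail m (B : 'I_k -> set mR) :=
  [set w | forall i : 'I_k, (m <= i)%N -> B i (W i w)].
have mtail m B : (forall i, measurable (B i)) -> measurable (tail m B).
  move=> mB; rewrite (_ : tail m B =
      \big[setI/setT]_(i < k | (m <= i)%N) (W i @^-1` B i)).
    by apply: bigsetI_measurable => i _; exact: measurable_preimageT.
  rewrite -bigcap_seq_cond; apply/seteqP; split=> w /= Bw i.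
    by move=> /andP[_]; exact: Bw.
  by move=> mi; apply: Bw => /=; rewrite mem_index_enum.
suff stage m : (m <= k)%N -> forall (D : set mR) (B : 'I_k -> set mR),
    measurable D -> (forall i, measurable (B i)) ->
    P (O `&` tail m B `&` [set w | D (V m w)]) =
    P O * (\prod_(i < k | (m <= i)%N) N (B i)) * noncentral_chi2 b m D.
  move=> D mD; have := stage k (leqnn k) D (fun=> setT) mD (fun=> measurableT).
  rewrite big_pred0 => [|i]; last by rewrite leqNgt ltn_ord.
  have VE w : V k w = (\sum_(i < k) (W i w + b i) ^+ 2)%R.
    by apply: eq_bigl => i; rewrite ltn_ord.
  rewrite mule1 => <-; congr (P _); apply/seteqP; split=> w /=; rewrite VE.
    by move=> [Ow Dw].
  by move=> [[Ow _] Dw].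
elim: m => [_ D B mD mB|m IH mk D B mD mB].
  have V0 w : V 0%N w = 0%R by rewrite /V big_pred0.
  have PT : P (O `&` tail 0%N B) = P O * \prod_(i < k) N (B i).
    rewrite -PB//; congr (P _); apply/seteqP; split=> w /= [Ow Bw]; split => //.
    by move=> i; exact: Bw.
  have [D0|D0] := pselect (D 0%R).
    rewrite (_ : [set w | _] = setT); last first.
      by apply/seteqP; split=> w //= _; rewrite V0.
    by rewrite setIT PT /= diracE mem_set// mule1.
  rewrite (_ : [set w | _] = set0); last first.
    by apply/seteqP; split=> w //=; rewrite V0.
  by rewrite setI0 measure0 /= diracE memNset// mule0.
pose i0 := Ordinal mk.
pose O' := O `&` tail m.+1 B.
have mO' : measurable O' by apply: measurableI => //; exact: mtail.
have rect (A1 A2 : set mR) : measurable A1 -> measurable A2 ->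
    P (O' `&` [set w | A1 (V m w) /\ A2 (W i0 w)]) =
    P O * (\prod_(i < k | (m < i)%N) N (B i)) *
      (noncentral_chi2 b m A1 * N A2).
  move=> mA1 mA2; pose B' i := if i == i0 then A2 else B i.
  have mB' i : measurable (B' i) by rewrite /B'; case: ifP.
  transitivity (P (O `&` tail m B' `&` [set w | A1 (V m w)])).
    congr (P _); apply/seteqP; split=> w /=.
      move=> [[Ow tw] [A1w A2w]]; split => //; split => // i mi.
      rewrite /B'; case: eqP => [->//|/eqP ii0]; apply: tw.
      by rewrite ltn_neqAle mi andbT; apply: contra ii0 => /eqP mE;
        apply/eqP/val_inj.
    move=> [[Ow tw] A1w]; split; first split => //.
      move=> i mi; have := tw i (ltnW mi); rewrite /B'.
      by case: eqP => // ii0; move: mi; rewrite ii0/= ltnn.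
    by split => //; have := tw i0 (leqnn _); rewrite /B' eqxx.
  rewrite IH//; last exact: ltnW.
  rewrite (bigD1 i0)//= /B' eqxx -!muleA; congr (_ * _).
  rewrite muleC -muleA; congr (_ * _).
  apply: eq_big => [i|i /andP[_ /negbTE ->]//].
  by rewrite [RHS]ltn_neqAle andbC eq_sym.
have PO' : P O' = P O * \prod_(i < k | (m < i)%N) N (B i).
  have := rect setT setT measurableT measurableT.
  rewrite !probability_setT !mule1 => <-; congr (P _).
  by apply/seteqP; split=> w //= [].
have Vm1 w : V m.+1 w = add_shifted_sqr (b m) (V m w, W i0 w).
  rewrite /V (bigD1 i0)//= addrC /add_shifted_sqr/=; congr (_ + _)%R.
  apply: eq_bigl => i; rewrite ltnS [RHS]ltn_neqAle andbC.
  by congr (_ && _); rewrite -val_eqE.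
rewrite -/O' -PO'.
rewrite (_ : [set w | _] = [set w | (add_shifted_sqr (b m) @^-1` D)
    (V m w, W i0 w)]); last by apply/seteqP; split=> w; rewrite /= Vm1.
apply: (indep_event_pair (Q1 := noncentral_chi2 b m) (Q2 := N)) => //.
- by move=> A1 A2 mA1 mA2; rewrite rect// -PO'.
- by apply: measurable_preimageT => //; exact: measurable_add_shifted_sqr.
Qed.

End sum_of_squares_law.

(** The rectangles, on which the product rule is known, generate the
    sigma-algebra of tuples. *)
Lemma measurable_tuple_generators d (S : measurableType d) k :
  let G := [set E : set (k.-tuple S) | exists A : 'I_k -> set S,
    (forall i, measurable (A i)) /\ E = [set u | forall i, A i (tnth u i)]] in
  [/\ measurable = <<s G >>, setI_closed G & G setT].
Proof.
move=> G; split.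
- apply/seteqP; split.
    apply: smallest_sub; first exact: smallest_sigma_algebra.
    rewrite -bigcup_seq => E [i /= _ [A mA <-]].
    apply: sub_sigma_algebra; exists (fun j => if j == i then A else setT).
    split; first by move=> j; case: ifP.
    apply/seteqP; split=> u /=.
      by move=> [_ Au] j; case: eqP => // ->.
    by move=> /(_ i); rewrite eqxx.
  apply: smallest_sub; first exact: sigma_algebra_measurable.
  move=> _ [A [mA ->]].
  rewrite (_ : [set _ | _] = \big[setI/setT]_i ((fun u => tnth u i) @^-1` A i)).
    apply: bigsetI_measurable => i _.
    exact: (measurable_preimageT (measurable_tnth i)).
  rewrite -bigcap_seq; apply/seteqP; split=> w /= Aw i.
    by move=> _; exact: Aw.
  by apply: Aw => /=; rewrite mem_index_enum.
- move=> _ _ [A [mA ->]] [B [mB ->]]; exists (fun i => A i `&` B i); split.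
    by move=> i; exact: measurableI.
  apply/seteqP; split=> u /=; first by move=> [Au Bu] i; split.
  by move=> ABu; split=> i; have [] := ABu i.
- by exists (fun=> setT); split => //; apply/seteqP; split.
Qed.

Section joint_law.
Context d (T : measurableType d) (R : realType) (P : probability T R).
Context (n : nat) (eps : 'I_n -> {RV P >-> R}) (C : {set gitv n./2}).
Hypotheses (n_even : ~~ odd n)
  (eps_normal : forall i, standard_normal (eps i))
  (eps_indep : independent_RVs eps)
  (C12 : forall I : gitv n./2, I \in C -> (I.1 < I.2)%N).
Local Open Scope ereal_scope.
Local Notation mR := (measurableTypeR R).
Local Notation N := (@normal_prob R 0 1 : probability mR R).
Local Notation k := n./2.

Let e (w : T) : 'I_n -> R := eps ^~ w.

Definition Zreg_noise (w : T) : mR := Zreg C (eps ^~ w).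

Lemma measurable_Zreg_noise : measurable_fun setT Zreg_noise.
Proof.
have [L [L0 FL]] := max_gap_lipschitz C12 (R := R).
apply: (measurable_fun_lipschitz (X := fun i w => epsbar (e w) i) L0 FL) => i.
exact: measurable_epsbar.
Qed.

HB.instance Definition _ :=
  isMeasurableFun.Build _ _ T mR Zreg_noise measurable_Zreg_noise.

Definition Zreg_law : probability mR R := distribution P Zreg_noise.

(** [Zreg] is a measurable function of the pairwise sums alone. *)
Lemma Zreg_indep_epsdiff (A : set mR) (B : 'I_k -> set mR) :
    measurable A -> (forall i, measurable (B i)) ->
  P ([set w | A (Zreg_noise w)] `&` [set w | forall i, B i (epsdiff (e w) i)]) =
  P [set w | A (Zreg_noise w)] * \prod_i N (B i).
Proof.
move=> mA mB.
pose U (w : T) : k.-tuple mR := [tuple epsbar (e w) i | i < k].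
have tU i w : tnth (U w) i = epsbar (e w) i by rewrite tnth_mktuple.
have mU : measurable_fun setT U.
  apply/measurable_fun_tnthP => i.
  rewrite (_ : _ \o _ = fun w => epsbar (e w) i : mR); last first.
    by apply/funext => w /=; rewrite tU.
  exact: measurable_epsbar.
pose Um : {mfun T >-> k.-tuple mR} := HB.pack U
  (isMeasurableFun.Build _ _ _ _ U mU).
pose Q : probability (k.-tuple mR) R := distribution P Um.
pose O := [set w | forall i, B i (epsdiff (e w) i)].
have PO : P O = \prod_i N (B i).
  have := rotated_noise_joint n_even eps_normal eps_indep
    (A := fun=> setT) (B := B) (fun=> measurableT) mB.
  under eq_bigr do rewrite probability_setT mul1e.
  move=> <-; congr (P _); apply/seteqP; split=> w /= Bw i;
    by have := Bw i; tauto.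
have mO : measurable O.
  rewrite (_ : O = \big[setI/setT]_i ((fun w => epsdiff (e w) i) @^-1` B i)).
    apply: bigsetI_measurable => i _.
    exact: (measurable_preimageT (measurable_epsdiff eps i)).
  rewrite -bigcap_seq; apply/seteqP; split=> w /= Bw i.
    by move=> _; exact: Bw.
  by apply: Bw => /=; rewrite mem_index_enum.
have [mG GI GT] := @measurable_tuple_generators _ mR k.
pose F (u : k.-tuple mR) : mR := max_gap C (tnth u).
have mF : measurable_fun setT F.
  have [L [L0 FL]] := max_gap_lipschitz C12 (R := R).
  apply: (measurable_fun_lipschitz (X := fun i u => tnth u i) L0 FL) => i.
  exact: measurable_tnth.
have FU w : F (U w) = Zreg_noise w.
  by congr max_gap; apply/funext => i; rewrite tU.
have := indep_event_generators mG GI GT mU mO (Q := Q) _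
  (measurable_preimageT mF mA).
rewrite (_ : U @^-1` _ = [set w | A (Zreg_noise w)]); last first.
  by apply/seteqP; split=> w /=; rewrite FU.
rewrite (_ : Q _ = P [set w | A (Zreg_noise w)]); last first.
  by congr (P _); apply/seteqP; split=> w /=; rewrite FU.
rewrite setIC -PO [RHS]muleC; apply.
move=> _ [A' [mA' ->]].
have QE : Q [set u | forall i, A' i (tnth u i)] = \prod_i N (A' i).
  have := rotated_noise_joint n_even eps_normal eps_indep
    (A := A') (B := fun=> setT) mA' (fun=> measurableT).
  under eq_bigr do rewrite probability_setT mule1.
  move=> <-; congr (P _); apply/seteqP; split=> w /= Aw i; have := Aw i;
    by rewrite ?tU; tauto.
rewrite PO QE -big_split/=.
under eq_bigr do rewrite muleC.
rewrite -(rotated_noise_joint n_even eps_normal eps_indep)//; congr (P _).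
apply/seteqP; split=> w /=.
  by move=> [Ow Aw] i; split; [rewrite -tU; exact: Aw|exact: Ow].
by move=> ABw; split=> i; [|rewrite tU]; have [] := ABw i.
Qed.

Lemma measurable_shifted_sumsq (b : nat -> R) :
  measurable_fun setT (fun w => shifted_sumsq b (e w) : mR).
Proof.
apply: measurable_sum => i; apply: measurable_funX.
by apply: measurable_funD => //; exact: measurable_epsdiff.
Qed.

(** The noncentral law of the sum of squares is carried along with the event
    [Zreg \in A], for each [A]; rectangles then determine the joint law. *)
Lemma Zreg_sumsq_law (b : nat -> R) (D : set (mR * mR)) : measurable D ->
  P [set w | D (Zreg_noise w, shifted_sumsq b (e w))] =
  (Zreg_law \x noncentral_chi2 b k) D.
Proof.
move=> mD; rewrite -[X in P X]setTI -[RHS]mul1e -(probability_setT P).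
apply: (indep_event_pair (X := Zreg_noise)
  (Q1 := Zreg_law) (Q2 := noncentral_chi2 b k)
  (Y := fun w => shifted_sumsq b (e w) : mR)) => //.
  exact: measurable_shifted_sumsq.
move=> A B mA mB; rewrite setTI probability_setT mul1e.
have mZ : measurable [set w | A (Zreg_noise w)].
  exact: (measurable_preimageT measurable_Zreg_noise).
apply: (indep_event_sum_sqr b (W := fun i w => epsdiff (e w) i) _ mZ) => //.
  by move=> i; exact: measurable_epsdiff.
by move=> B' mB'; exact: Zreg_indep_epsdiff.
Qed.

End joint_law.

(** * Tails of the studentized statistic *)

Section studentized_tail.
Context {R : realType}.
Local Open Scope ereal_scope.
Local Notation mR := (measurableTypeR R).

Lemma noncentral_chi2_0 (k : nat) (A : set mR) : measurable A ->
  noncentral_chi2 (fun=> 0%R) k A = chi2 k A.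
Proof.
elim: k A => [//|k IH] A mA /=; rewrite /distribution /pushforward.
have -> : add_shifted_sqr 0 = add_sqr :> (mR * mR -> mR).
  by apply/funext => p; rewrite /add_shifted_sqr addr0.
have mD : measurable (add_sqr @^-1` A).
  by apply: measurable_preimageT => //; exact: measurable_add_sqr.
rewrite !product_prob_ysection//; apply: eq_integral => y _.
by apply: IH; exact: measurable_ysection.
Qed.

Let measurable_lt (v : R) : measurable [set x : mR | (x < v)%R].
Proof. by apply: measurable_set_lt. Qed.

(** When [v <= 0] the square root is 0, and division by 0 gives 0: the ratio
    then exceeds no nonnegative level. *)
Lemma studentize_gtP (k : nat) (r z v : R) : (0 < k)%N -> (0 <= r)%R ->
  (r < studentize k z v)%R <->
  [/\ (0 < v)%R, (0 < z)%R & r = 0%R \/ (v < k%:R * (z / r) ^+ 2)%R].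
Proof.
move=> k0 r0; have kR : (0 < k%:R :> R)%R by rewrite ltr0n.
have [v0|v0] := leP v 0%R.
  rewrite /studentize ler0_sqrtr ?invr0 ?mulr0; last first.
    by rewrite pmulr_lle0// invr_gt0.
  by split=> [|[]//]; rewrite ltNge r0.
have s0 : (0 < Num.sqrt (v / k%:R))%R by rewrite sqrtr_gt0 divr_gt0.
rewrite /studentize ltr_pdivlMr//.
have [->|rn0] := eqVneq r 0%R.
  by rewrite mul0r; split=> [z0|[]//]; split => //; left.
have {r0 rn0}r0 : (0 < r)%R by rewrite lt_neqAle eq_sym rn0.
have sqrtE : (0 < z)%R ->
    (r * Num.sqrt (v / k%:R) < z)%R = (v < k%:R * (z / r) ^+ 2)%R.
  move=> z0; rewrite mulrC -ltr_pdivlMr//.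
  have zr0 : (0 < z / r)%R by rewrite divr_gt0.
  rewrite -[X in (_ < X)%R = _](ger0_norm (ltW zr0)) -sqrtr_sqr.
  rewrite ltr_sqrt ?exprn_gt0//.
  by rewrite ltr_pdivrMr// mulrC.
split=> [rz|[_ z0 [r0'|]]].
- have z0 : (0 < z)%R by apply: lt_trans rz; rewrite mulr_gt0.
  by split => //; right; rewrite -sqrtE.
- by rewrite r0' ltxx in r0.
- by rewrite sqrtE.
Qed.

Lemma measurable_studentize_set (k : nat) (A : set R) : measurable A ->
  measurable [set p : mR * mR | A (studentize k p.1 p.2)].
Proof. exact: (measurable_preimageT (@measurable_studentize R k)). Qed.

(** For fixed [z > 0], exceeding a nonnegative level means that [v] is positive
    and below some bound (or just positive when the level is 0), and the
    chi-square law does not charge the nonpositive half-line. *)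
Lemma studentize_tail_le (Q : probability mR R)
    (b : nat -> R) (k : nat) (r : R) : (0 < k)%N -> (0 <= r)%R ->
  (Q \x noncentral_chi2 b k) [set p | (r < studentize k p.1 p.2)%R] <=
  (Q \x chi2 k) [set p | (r < studentize k p.1 p.2)%R].
Proof.
move=> k0 r0.
have mD : measurable [set p : mR * mR | (r < studentize k p.1 p.2)%R].
  have := measurable_studentize_set k (measurable_itv `]r, +oo[).
  by under eq_set do rewrite /= in_itv/= andbT.
apply: product_prob_xsection_le => // z.
set D := xsection _ z.
have mDz : measurable D by exact: measurable_xsection.
have DP v : D v <-> (r < studentize k z v)%R.
  by rewrite /D /xsection /= inE.
have [z0|z0] := leP z 0%R.
  rewrite (_ : D = set0) ?measure0//; apply/seteqP; split=> v //.
  by rewrite DP studentize_gtP// => -[_]; rewrite ltNge z0.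
have [S [mS SE SD]] : exists S : set mR, [/\ measurable S,
    noncentral_chi2 b k S <= chi2 k S &
    forall v, D v <-> (0 < v)%R /\ S v].
  have [rE|rn0] := eqVneq r 0%R.
    exists setT; split => //; first by rewrite !probability_setT.
    move=> v; rewrite DP studentize_gtP//; split=> [[]|[]] //.
    by split => //; left.
  exists [set v : mR | (v < k%:R * (z / r) ^+ 2)%R]; split => //.
    exact: noncentral_chi2_lt.
  move=> v; rewrite DP studentize_gtP//; split=> [[? _ [/eqP|]]|[]] //.
    by rewrite (negbTE rn0).
  by split => //; right.
apply: (@le_trans _ _ (noncentral_chi2 b k S)).
  by apply: le_measure; rewrite ?inE// => v /SD[].
apply: le_trans SE _.
apply: (@le_trans _ _ (chi2 k (D `|` [set v : mR | (v <= 0)%R]))).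
  apply: le_measure; rewrite ?inE//.
    by apply: measurableU => //; exact: measurable_set_le.
  move=> v Sv /=; have [v0|v0] := leP v 0%R; first by right.
  by left; apply/SD.
apply: le_trans (measureU2 _ _ _) _ => //; first exact: measurable_set_le.
by rewrite [X in _ + X]chi2_le0// adde0.
Qed.

(** For fixed [z], at most one [v] gives the nonzero value [x], and the
    chi-square law has no atom. *)
Lemma studentize_eq0 (Q : probability mR R) (k : nat) (x : R) : (0 < k)%N ->
  x != 0%R -> (Q \x chi2 k) [set p | studentize k p.1 p.2 = x] = 0.
Proof.
move=> k0 x0; have kR : (0 < k%:R :> R)%R by rewrite ltr0n.
apply: product_prob_xsection_eq0 => z.
set D := xsection _ z.
have mD : measurable D.
  apply: measurable_xsection.
  exact: (measurable_studentize_set k (measurable_set1 x)).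
have m1 : measurable [set (k%:R * (z / x) ^+ 2)%R : mR] by [].
apply: (subset_measure0 mD m1); last exact: chi2_set1.
move=> v; rewrite /D /xsection/= inE/= => xE.
have [v0|v0] := leP v 0%R.
  move: x0; rewrite -xE /studentize ler0_sqrtr ?invr0 ?mulr0 ?eqxx//.
  by rewrite pmulr_lle0// invr_gt0.
have s0 : (0 < Num.sqrt (v / k%:R))%R by rewrite sqrtr_gt0 divr_gt0.
have z0 : z != 0%R.
  by apply: contra x0 => /eqP z0; rewrite -xE /studentize z0 mul0r.
rewrite -xE /studentize invf_div [X in (X ^+ 2)%R]mulrCA divff// mulr1.
rewrite sqr_sqrtr; last by rewrite divr_ge0// ltW.
by rewrite mulrC divfK// gt_eqF.
Qed.

Lemma studentize_le0 (Q : probability mR R) (k : nat) : (0 < k)%N ->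
  (Q \x chi2 k) [set p | (studentize k p.1 p.2 <= 0)%R] <=
  Q [set z | (z <= 0)%R].
Proof.
move=> k0; have kR : (0 < k%:R :> R)%R by rewrite ltr0n.
have mle0 : measurable [set z : mR | (z <= 0)%R] by exact: measurable_set_le.
have mX : measurable ([set z : mR | (z <= 0)%R] `*` [set: mR]).
  exact: measurableX.
have mY : measurable ([set: mR] `*` [set z : mR | (z <= 0)%R]).
  exact: measurableX.
apply: (@le_trans _ _ ((Q \x chi2 k)
  (([set z : mR | (z <= 0)%R] `*` [set: mR]) `|`
   ([set: mR] `*` [set v : mR | (v <= 0)%R])))).
  apply: le_measure; rewrite ?inE.
  - have := measurable_studentize_set k (measurable_itv `]-oo, 0%R]).
    by under eq_set do rewrite /= in_itv/=.
  - exact: measurableU.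
  - move=> -[z v] /=; have [|z0] := leP z 0%R; first by left.
    have [|v0] := leP v 0%R; first by right.
    rewrite leNgt => /negP[].
    by rewrite divr_gt0// sqrtr_gt0 divr_gt0.
apply: le_trans (measureU2 _ _ _) _ => //.
rewrite /= !product_measure1E//= [X in _ * X + _]probability_setT mule1.
by rewrite [X in _ + _ * X]chi2_le0// mule0 adde0.
Qed.

End studentized_tail.

(** * Tails beyond a quantile *)

Section quantile_theory.
Context d (T : measurableType d) (R : realType) (P : probability T R).
Variables (X : T -> R) (p : R).
Hypotheses (mX : measurable_fun setT X) (X0 : forall w, 0 <= X w).
Hypotheses (p0 : 0 < p) (p1 : p < 1).

Local Notation q := (quantile P X p).

Let S := [set x | (p%:E <= P [set w | (X w <= x)%R])%E].

Let mle x : measurable [set w | X w <= x].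
Proof. exact: measurable_set_le. Qed.

Let S_ge0 x : S x -> 0 <= x.
Proof.
rewrite /S/=; have [//|x0] := leP 0 x.
rewrite (_ : [set w | _] = set0).
  by rewrite measure0 lee_fin leNgt p0.
by apply/seteqP; split=> w //=; rewrite leNgt (lt_le_trans x0).
Qed.

Let S_neq0 : S !=set0.
Proof.
apply: contrapT => /forallNP noS.
suff : (1 <= p%:E)%E by rewrite lee_fin leNgt p1.
pose F (m : nat) := [set w | X w <= m%:R].
have UF : \bigcup_m F m = setT.
  apply/seteqP; split=> w // _; exists (Num.truncn (X w)).+1 => //=.
  exact/ltW/truncnS_gt.
have mF m : measurable (F m) by exact: mle.
have ndF : nondecreasing_seq F.
  move=> i j ij; apply/subsetPset => w; rewrite /F/= => /le_trans; apply.
  by rewrite ler_nat.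
have mUF : measurable (\bigcup_m F m) by rewrite UF.
have := nondecreasing_cvg_mu (mu := P) mF mUF ndF; rewrite UF => cv.
rewrite -(probability_setT P); apply: (cvge_to_le cv).
by near=> m; have /negP := noS m%:R; rewrite -ltNge => /ltW.
Unshelve. all: by end_near. Qed.

Let has_infS : has_inf S.
Proof. by split => //; exists 0 => x; exact: S_ge0. Qed.

Lemma quantile_ge0 : 0 <= q.
Proof. by apply: lb_le_inf => // x; exact: S_ge0. Qed.

Lemma lt_quantile x : x < q -> (P [set w | (X w <= x)%R] < p%:E)%E.
Proof.
move=> xq; rewrite ltNge; apply/negP => Sx; move: xq; rewrite ltNge => /negP[].
by apply: ge_inf => //; have [] := has_infS.
Qed.

Lemma gt_quantile x : q < x -> (p%:E <= P [set w | (X w <= x)%R])%E.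
Proof.
move=> /(inf_lt S_neq0)[y Sy yx]; apply: le_trans Sy _.
by apply: le_measure; rewrite ?inE// => w /= /le_trans; apply; exact: ltW.
Qed.

Lemma le_cdf_quantile : (p%:E <= P [set w | (X w <= q)%R])%E.
Proof.
pose F (m : nat) := [set w | X w <= q + m.+1%:R^-1].
have IF : \bigcap_m F m = [set w | X w <= q].
  apply/seteqP; split=> w /=.
    move=> Xw; rewrite leNgt; apply/negP => /ltr_add_invr[m].
    by rewrite ltNge Xw.
  by move=> Xw m _; rewrite /F/= (le_trans Xw)// lerDl.
have mF m : measurable (F m) by exact: mle.
have niF : nonincreasing_seq F.
  move=> i j ij; apply/subsetPset => w; rewrite /F/= => /le_trans; apply.
  by rewrite lerD2l lef_pV2 ?posrE// ler_nat.
have mIF : measurable (\bigcap_m F m) by rewrite IF.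
have F0 : (P (F 0%N) < +oo)%E.
  by apply: le_lt_trans (probability_le1 _ _) _ => //; exact: ltry.
have := nonincreasing_cvg_mu (mu := P) F0 mF mIF niF; rewrite IF => cv.
apply: (cvge_to_ge cv).
by near=> m; apply: gt_quantile; rewrite ltrDl.
Unshelve. all: by end_near. Qed.

Lemma prob_lt_quantile : (P [set w | (X w < q)%R] <= p%:E)%E.
Proof.
pose F (m : nat) := [set w | X w <= q - m.+1%:R^-1].
have UF : \bigcup_m F m = [set w | X w < q].
  apply/seteqP; split=> w /=.
    by move=> [m _ /= Xw]; rewrite (le_lt_trans Xw)// ltrBlDr ltrDl.
  move=> /ltr_add_invr[m Xm]; exists m => //=.
  by rewrite /F/= lerBrDr ltW.
have mF m : measurable (F m) by exact: mle.
have ndF : nondecreasing_seq F.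
  move=> i j ij; apply/subsetPset => w; rewrite /F/= => /le_trans; apply.
  by rewrite lerD2l lerN2 lef_pV2 ?posrE// ler_nat.
have mUF : measurable (\bigcup_m F m) by rewrite UF; exact: measurable_set_lt.
have := nondecreasing_cvg_mu (mu := P) mF mUF ndF; rewrite UF => cv.
apply: (cvge_to_le cv).
by near=> m; apply/ltW/lt_quantile; rewrite ltrBlDr ltrDl.
Unshelve. all: by end_near. Qed.

Lemma prob_gt_quantile : (P [set w | (q < X w)%R] <= (1 - p)%:E)%E.
Proof.
rewrite (_ : [set w | _] = ~` [set w | X w <= q]); last first.
  by apply/seteqP; split=> w /=; rewrite ltNge => /negP.
rewrite probability_setC// EFinB leeB//; exact: le_cdf_quantile.
Qed.

(** The distribution function can only jump over [p] at an atom, hence at 0,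
    where its value is assumed to be at most [p]. *)
Lemma prob_gt_quantile_eq : (P [set w | (X w <= 0)%R] <= p%:E)%E ->
  (forall x, 0 < x -> P [set w | X w = x] = 0) ->
  P [set w | (q < X w)%R] = (1 - p)%:E.
Proof.
move=> Pp0 atom.
suff Pq : (P [set w | (X w <= q)%R] <= p%:E)%E.
  rewrite (_ : [set w | _] = ~` [set w | X w <= q]); last first.
    by apply/seteqP; split=> w /=; rewrite ltNge => /negP.
  rewrite probability_setC// (_ : P _ = p%:E)//.
  by apply/eqP; rewrite eq_le Pq; exact: le_cdf_quantile.
have := quantile_ge0; rewrite le_eqVlt => /orP[/eqP <-//|q0].
have meq : measurable [set w | X w = q].
  exact: (measurable_preimageT mX (measurable_set1 q)).
rewrite (_ : [set w | _] = [set w | X w < q] `|` [set w | X w = q]).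
  apply: le_trans (measureU2 _ _ _) _ => //; first exact: measurable_set_lt.
  by rewrite [X in (_ + X)%E]atom// adde0; exact: prob_lt_quantile.
apply/seteqP; split=> w /=; rewrite le_eqVlt.
  by move=> /orP[/eqP|]; [right|left].
by move=> [->|->]; rewrite ?orbT ?eqxx.
Qed.

End quantile_theory.

(** * Rejection probabilities *)

Section rejection_probability.
Context d (T : measurableType d) (R : realType) (P : probability T R).
Context (n : nat) (eps : 'I_n -> {RV P >-> R}) (C : {set gitv n./2}).
Context (sigma : R).
Hypotheses (n0 : (0 < n)%N) (n_even : ~~ odd n) (sigma0 : 0 < sigma)
  (C12 : forall I : gitv n./2, I \in C -> (I.1 < I.2)%N)
  (eps_normal : forall i, standard_normal (eps i))
  (eps_indep : independent_RVs eps).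
Local Open Scope ereal_scope.
Local Notation mR := (measurableTypeR R).
Local Notation k := n./2.

(** The random variable whose quantile is the threshold. *)
Definition pivot (w : T * mR) : R := studentize k (Zreg C (eps ^~ w.1)) w.2.

Let k0 : (0 < k)%N.
Proof. by move: n0 n_even; case: n => [|[|m]]. Qed.

Let mZ : measurable_fun setT (Zreg_noise eps C).
Proof. exact: measurable_Zreg_noise. Qed.

Local Notation Q := (Zreg_law eps C12).

Lemma measurable_pivot : measurable_fun setT pivot.
Proof.
apply: (measurableT_comp (@measurable_studentize R k)
  (g := fun w : T * mR => (Zreg_noise eps C w.1 : R, w.2 : R))).
apply: measurable_fun_pair => //.
exact: (measurableT_comp mZ).
Qed.

Lemma pivot_ge0 w : (0 <= pivot w)%R.
Proof. by rewrite divr_ge0 ?sqrtr_ge0//; exact: bigmax_ge_id. Qed.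

Let pivot_law (D : set (mR * mR)) : measurable D ->
  (P \x chi2 k) [set w | D (Zreg C (eps ^~ w.1), w.2)] = (Q \x chi2 k) D.
Proof.
move=> mD; rewrite /product_measure1/=.
by rewrite ge0_integral_pushforward//; exact: measurable_fun_xsection.
Qed.

Let Dtail (r : R) := [set p : mR * mR | (r < studentize k p.1 p.2)%R].

Let mDtail r : measurable (Dtail r).
Proof.
have := measurable_studentize_set k (measurable_itv `]r, +oo[).
by under eq_set do rewrite /= in_itv/= andbT.
Qed.

Let law_tail (b : nat -> R) (r : R) :
  P [set w | (r < studentize k (Zreg C (eps ^~ w))
                    (shifted_sumsq b (eps ^~ w)))%R] =
  (Q \x noncentral_chi2 b k) (Dtail r).
Proof.
rewrite -(Zreg_sumsq_law n_even eps_normal eps_indep C12 b (mDtail r)).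
by [].
Qed.

Let null_tail r : (Q \x noncentral_chi2 (fun=> 0%R) k) (Dtail r) =
  (P \x chi2 k) [set w | (r < pivot w)%R].
Proof.
rewrite (pivot_law (mDtail r)); apply: eq_integral => z _ /=.
by apply: noncentral_chi2_0; exact: measurable_xsection.
Qed.

(** In the constant case the drift vanishes, and the independence of [Zreg] and
    of the sum of squares makes the largest statistic distributed like the
    pivot. *)
Lemma rejection_prob_cst (r c : R) :
  rejection_prob C eps sigma r (fun=> c) =
  (P \x chi2 k) [set w | (r < pivot w)%R].
Proof.
rewrite -null_tail -law_tail; congr (P _).
by apply/seteqP; split=> w /=; rewrite max_Sreg_cst.
Qed.

Let measurable_rejection (f : R -> R) (r : R) :
  measurable [set w | (r < max_Sreg C (regression f sigma (eps ^~ w)))%R].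
Proof.
have mY i : measurable_fun setT
    (fun w => Ybar (regression f sigma (eps ^~ w)) i).
  have me j : measurable_fun setT (eps j : T -> R) by exact: measurable_funPT.
  apply: measurable_funM => //; apply: measurable_funD;
    by apply: measurable_funD => //; apply: measurable_funM => //; exact: me.
have [L [L0 FL]] := max_gap_lipschitz C12 (R := R).
have mG := measurable_fun_lipschitz L0 FL mY.
under eq_set do rewrite max_Sreg_studentize//.
apply: measurable_set_lt => //.
apply: (measurableT_comp (@measurable_studentize R k)
  (g := fun w => (max_gap C (Ybar (regression f sigma (eps ^~ w))) /
      (sigma / Num.sqrt 2) : R,
    shifted_sumsq (drift f sigma) (eps ^~ w) : R)%R)).
apply: measurable_fun_pair; first exact: measurable_funM.
exact: measurable_shifted_sumsq.
Qed.

(** The numerator of the statistic is bounded pointwise, its denominator only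
    in law, conditionally on the numerator. *)
Lemma rejection_prob_le_cst (r c : R) (f : R -> R) : (0 <= r)%R ->
  nonincreasing01 f ->
  rejection_prob C eps sigma r f <= rejection_prob C eps sigma r (fun=> c).
Proof.
move=> r0 fd; rewrite rejection_prob_cst.
rewrite [leRHS](_ : _ = (Q \x chi2 k) (Dtail r)); last exact: pivot_law.
apply: le_trans (studentize_tail_le Q (drift f sigma (n := n)) k0 r0).
rewrite -law_tail; apply: le_measure; rewrite ?inE//.
  have mV := measurable_shifted_sumsq eps (drift f sigma (n := n)).
  apply: measurable_set_lt => //.
  apply: (measurableT_comp (@measurable_studentize R k)
    (g := fun w => (Zreg_noise eps C w : R,
      shifted_sumsq (drift f sigma) (eps ^~ w) : R))).
  exact: measurable_fun_pair.
by move=> w /= rS; apply: lt_le_trans rS _; exact: max_Sreg_le.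
Qed.

Lemma pivot_le0 : (P \x chi2 k) [set w | (pivot w <= 0)%R] <=
  1 - P [set w | (0 < Zreg C (eps ^~ w))%R].
Proof.
have mD : measurable [set p : mR * mR | (studentize k p.1 p.2 <= 0)%R].
  by apply: measurable_set_le => //; exact: measurable_studentize.
rewrite [leLHS](_ : _ = (Q \x chi2 k)
  [set p | (studentize k p.1 p.2 <= 0)%R]); last exact: (pivot_law mD).
apply: le_trans (studentize_le0 _ k0) _.
have mgt : measurable [set w | (0 < Zreg C (eps ^~ w))%R].
  by apply: measurable_set_lt => //; exact: mZ.
rewrite -probability_setC// [leLHS](_ : _ =
  P [set w | (Zreg C (eps ^~ w) <= 0)%R])//.
apply: le_measure; rewrite ?inE.
- by apply: measurable_set_le => //; exact: mZ.
- exact: measurableC.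
- by move=> w /=; rewrite leNgt => /negP.
Qed.

Lemma pivot_atom (x : R) : (0 < x)%R ->
  (P \x chi2 k) [set w | pivot w = x] = 0.
Proof.
move=> x0; have mD : measurable [set p : mR * mR | studentize k p.1 p.2 = x].
  exact: (measurable_studentize_set k (measurable_set1 x)).
rewrite [LHS](_ : _ = (Q \x chi2 k) [set p | studentize k p.1 p.2 = x]);
  last exact: (pivot_law mD).
by apply: studentize_eq0 => //; rewrite gt_eqF.
Qed.

End rejection_probability.

Theorem theorem4p1 (R : realType) (n : nat) (sigma : R)
    (C : {set gitv n./2})
    (d : measure_display) (T : measurableType d) (P : probability T R)
    (eps : 'I_n -> {RV P >-> R}) (alpha : R) :
  (0 < n)%N -> ~~ odd n -> 0 < sigma ->
  (forall I : gitv n./2, I \in C -> (I.1 < I.2)%N) ->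
  (forall i : 'I_n, standard_normal (eps i)) -> independent_RVs eps ->
  0 < alpha -> alpha < 1 ->
  let r := threshold C eps alpha in
  let sup_rejection :=
    ereal_sup [set rejection_prob C eps sigma r f | f in nonincreasing01] in
  [/\ (sup_rejection <= alpha%:E)%E,
      (alpha%:E <= P [set w | (0 < Zreg C (eps ^~ w))%R])%E ->
        sup_rejection = alpha%:E
    & forall c : R, rejection_prob C eps sigma r (fun=> c) = sup_rejection].
Proof.
move=> n0 n_even sigma0 C12 eps_normal eps_indep alpha0 alpha1 r sup_rejection.
have mX := measurable_pivot eps C12.
have X0 := @pivot_ge0 _ T R P n eps C.
have p0 : 0 < 1 - alpha by rewrite subr_gt0.
have p1 : 1 - alpha < 1 by rewrite ltrBlDr ltrDl.
have r0 : 0 <= r := quantile_ge0 (P \x chi2 n./2)%E mX X0 p0 p1.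
have supE c : rejection_prob C eps sigma r (fun=> c) = sup_rejection.
  apply/eqP; rewrite eq_le; apply/andP; split.
    by apply: ereal_sup_ubound; exists (fun=> c).
  by apply: ge_ereal_sup => _ [f fd <-]; exact: rejection_prob_le_cst.
have supX : sup_rejection = (P \x chi2 n./2)%E [set w | (r < pivot eps C w)%R].
  by rewrite -(supE 0) (rejection_prob_cst n0 n_even sigma0 C12).
have alphaE : 1 - (1 - alpha) = alpha by rewrite opprB addrC subrK.
split=> //; first by rewrite supX -alphaE; exact: prob_gt_quantile.
move=> alphaZ; rewrite supX -[in RHS]alphaE.
apply: (prob_gt_quantile_eq mX X0 p0 p1) => [|x x0]; last exact: pivot_atom.
by apply: le_trans (pivot_le0 eps n0 n_even C12) _; rewrite EFinB leeB.
Qed.
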